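(* Let $H$ be a conilpotent Hopf algebra over $k$ and let $A$ be a unital associative $k$-algebra. Then there is a natural isomorphism (a bijection, natural in $H$ and $A$) between the set of unital algebra maps from $H$ to $A$ and the set of Hopf algebra maps from $H$ to the quasi-shuffle Hopf algebra $QSh(A)$: $$\mathrm{Hom}_{Alg}(H,A)\cong \mathrm{Hom}_{Hopf}(H,QSh(A)).$$
   Context: Everything is over a fixed field $k$ of characteristic $0$. Conilpotent: for a bialgebra $H$ with coproduct $\Delta$, counit $\eta$ and $H^+=\ker\eta$, the reduced coproduct on $H^+$ is $\Delta'(h)=\Delta(h)-1\otimes h-h\otimes 1$; its iterates are $\Delta'^{[1]}=\mathrm{Id}$, $\Delta'^{[n+1]}=(\mathrm{Id}\otimes\Delta'^{[n]})\circ\Delta'$. $H$ is conilpotent if for each $h\in H^+$ there is $n\ge 1$ with $\Delta'^{[n]}(h)=0$. A conilpotent bialgebra is automatically a Hopf algebra. Quasi-shuffle Hopf algebra $QSh(A)$ of an associative (not necessarily unital) algebra $A$ with product $\cdot_A$: as a graded vector space $QSh(A)=\bigoplus_{n\ge 0}A^{\otimes n}$ with $A^{\otimes 0}=k$; an element $a_1\otimes\cdots\otimes a_n\in A^{\otimes n}$ is written as a word $a_1\cdots a_n$. The unit $1$ is $1\in k=A^{\otimes 0}$ (different from $1_A\in A=A^{\otimes 1}$ if $A$ is unital). The product $\star$ is the quasi-shuffle product defined inductively by $1\star v=v\star 1=v$ and, for $a,b\in A$ and words $v,w$, $$av\star bw=a(v\star bw)+b(av\star w)+(a\cdot_A b)(v\star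 w).$$ The coproduct is deconcatenation, $\Delta(a_1\cdots a_s)=\sum_{r=0}^{s}(a_1\cdots a_r)\otimes(a_{r+1}\cdots a_s)$ (empty words being $1$), and the counit is $1\mapsto 1$, $a_1\cdots a_s\mapsto 0$ for $s\ge1$. $QSh(A)$ is a conilpotent bialgebra, hence a Hopf algebra. An algebra map $l:A\to B$ induces a Hopf algebra map $QSh(l):QSh(A)\to QSh(B)$, $a_1\cdots a_r\mapsto l(a_1)\cdots l(a_r)$. *)

(* Defs.v *)
From HB Require Import structures.
From mathcomp Require Import all_boot all_order all_algebra.
From mathcomp Require Import finmap boolp.
From mathcomp.multinomials Require Import monalg.

Set Implicit Arguments.
Unset Strict Implicit.
Unset Printing Implicit Defensive.

Import GRing.Theory.
Local Open Scope ring_scope.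
Local Open Scope quotient_scope.

Reserved Notation "u ⊗ v" (at level 40, left associativity).
Reserved Notation "x ⋅ y" (at level 40, left associativity).

Section LinearExtension.
Variables (k : fieldType) (X : choiceType) (W : lmodType k) (f : X -> W).

Definition linext (g : {malg k[X]}) : W := \sum_(x <- msupp g) g@_x *: f x.

Lemma linextEw (d : {fset X}) (g : {malg k[X]}) :
  (msupp g `<=` d)%fset -> linext g = \sum_(x <- d) g@_x *: f x.
Proof.
move=> le; rewrite /linext; apply: big_fset_incl => // x _.
by move=> /mcoeff_outdom ->; rewrite scale0r.
Qed.

Lemma linext_is_linear : linear linext.
Proof.
move=> a g h; pose d := (msupp g `|` msupp h)%fset.
have sg : (msupp g `<=` d)%fset by exact: fsubsetUl.
have sh : (msupp h `<=` d)%fset by exact: fsubsetUr.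
have sgh : (msupp (a *: g + h) `<=` d)%fset.
  apply: fsubset_trans (msuppD_le _ _) _.
  by rewrite fsetSU // msuppZ_le.
rewrite (linextEw sg) (linextEw sh) (linextEw sgh) scaler_sumr -big_split /=.
by apply: eq_bigr => x _; rewrite mcoeffD mcoeffZ scalerDl scalerA.
Qed.
HB.instance Definition _ :=
  GRing.isLinear.Build k {malg k[X]} W *:%R linext linext_is_linear.

Lemma linextU x : linext << x >> = f x.
Proof.
by rewrite (linextEw msuppU_le) big_seq_fset1 mcoeffUU scale1r.
Qed.

End LinearExtension.

Definition bilin (k : fieldType) (U V W : lmodType k) (f : U -> V -> W) : Prop :=
  (forall v, linear (f^~ v)) /\ (forall u, linear (f u)).

(* The k-module generated by X subject to the relators R : the quotient of the
   free module {malg k[X]} by the submodule [relspan] spanned by R. *)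
Section Presentation.
Variables (k : fieldType) (X : choiceType) (R : {malg k[X]} -> Prop).

Inductive relspan : {malg k[X]} -> Prop :=
  | relspan0 : relspan 0
  | relspanP a r g : R r -> relspan g -> relspan (a *: r + g).

Lemma relspanD g h : relspan g -> relspan h -> relspan (g + h).
Proof.
by elim=> [|a r g' Rr _ IH] h_s; rewrite ?add0r // -addrA; apply/relspanP/IH.
Qed.

Lemma relspanZ a g : relspan g -> relspan (a *: g).
Proof.
elim=> [|b r g' Rr _ IH]; first by rewrite scaler0; exact: relspan0.
by rewrite scalerDr scalerA; apply: relspanP.
Qed.

Lemma relspanN g : relspan g -> relspan (- g).
Proof. by rewrite -scaleN1r; exact: relspanZ. Qed.

Lemma relspan_rel r : R r -> relspan r.
Proof.
by move=> Rr; rewrite -[r]scale1r -[_ *: _]addr0; apply: relspanP => //; exact: relspan0.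
Qed.

Definition relequiv (g h : {malg k[X]}) : bool := `[< relspan (g - h) >].

Lemma relequiv_is_equiv : equiv_class_of relequiv.
Proof.
split=> [g|g h|h g l].
- by apply/asboolP; rewrite subrr; exact: relspan0.
- by apply/asboolP/asboolP => /relspanN; rewrite opprB.
- move=> /asboolP gh /asboolP hl; apply/asboolP.
  by rewrite -[g](addrNK h) -addrA; apply: relspanD.
Qed.
Canonical relequiv_equiv := EquivRelPack relequiv_is_equiv.
Canonical relequiv_encModRel := defaultEncModRel relequiv.

Definition presmod := {eq_quot relequiv}.
HB.instance Definition _ : EqQuotient _ relequiv presmod := EqQuotient.on presmod.
HB.instance Definition _ := Choice.on presmod.

Lemma presmod_eq g h : relspan (g - h) <-> g = h %[mod presmod].
Proof. by split=> [?|/eqP]; [apply/eqP; rewrite piE; apply/asboolP|rewrite piE => /asboolP]. Qed.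

Lemma presmod_repr g : relspan (repr (\pi_presmod g) - g).
Proof. by apply/presmod_eq; rewrite reprK. Qed.

End Presentation.

(* The operations, [gen], [pure], [word] and the products below are locked:
   otherwise unification unfolds them down to finitely supported functions. *)
HB.lock Definition presmod_zero (k : fieldType) (X : choiceType)
  (R : {malg k[X]} -> Prop) : presmod R := \pi_(presmod R) 0.
HB.lock Definition presmod_add (k : fieldType) (X : choiceType)
  (R : {malg k[X]} -> Prop) (u v : presmod R) : presmod R :=
  \pi_(presmod R) (repr u + repr v).
HB.lock Definition presmod_opp (k : fieldType) (X : choiceType)
  (R : {malg k[X]} -> Prop) (u : presmod R) : presmod R :=
  \pi_(presmod R) (- repr u).
HB.lock Definition presmod_scale (k : fieldType) (X : choiceType)
  (R : {malg k[X]} -> Prop) (a : k) (u : presmod R) : presmod R :=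
  \pi_(presmod R) (a *: repr u).

Section PresentationModule.
Variables (k : fieldType) (X : choiceType) (R : {malg k[X]} -> Prop).
Local Notation presmod := (presmod R).
Local Notation relspan := (relspan R).
Local Notation presmod_zero := (presmod_zero R).
Local Notation presmod_add := (@presmod_add k X R).
Local Notation presmod_opp := (@presmod_opp k X R).
Local Notation presmod_scale := (@presmod_scale k X R).

Fact presmod_addE g h :
  presmod_add (\pi g) (\pi h) = \pi_presmod (g + h).
Proof.
by rewrite unlock; apply/presmod_eq; rewrite opprD addrACA; apply: relspanD; exact: presmod_repr.
Qed.
Fact presmod_oppE g : presmod_opp (\pi g) = \pi_presmod (- g).
Proof. by rewrite unlock; apply/presmod_eq; rewrite -opprD; apply: relspanN; exact: presmod_repr. Qed.
Fact presmod_scaleE a g : presmod_scale a (\pi g) = \pi_presmod (a *: g).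
Proof. by rewrite unlock; apply/presmod_eq; rewrite -scalerBr; apply: relspanZ; exact: presmod_repr. Qed.

Fact presmod_addA : associative presmod_add.
Proof.
by elim/quotW=> u; elim/quotW=> v; elim/quotW=> w; rewrite !presmod_addE addrA.
Qed.
Fact presmod_addC : commutative presmod_add.
Proof. by elim/quotW=> u; elim/quotW=> v; rewrite !presmod_addE addrC. Qed.
Fact presmod_add0 : left_id presmod_zero presmod_add.
Proof. by rewrite presmod_zero.unlock; elim/quotW=> u; rewrite presmod_addE add0r. Qed.
Fact presmod_addN : left_inverse presmod_zero presmod_opp presmod_add.
Proof. by rewrite presmod_zero.unlock; elim/quotW=> u; rewrite presmod_oppE presmod_addE addNr. Qed.
HB.instance Definition _ := GRing.isZmodule.Build presmod
  presmod_addA presmod_addC presmod_add0 presmod_addN.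

Fact presmod_piD g h : \pi_presmod g + \pi_presmod h = \pi_presmod (g + h).
Proof. exact: presmod_addE. Qed.

Fact presmod_scaleA a b u :
  presmod_scale a (presmod_scale b u) = presmod_scale (a * b) u.
Proof. by elim/quotW: u => u; rewrite !presmod_scaleE scalerA. Qed.
Fact presmod_scale1 : left_id 1 presmod_scale.
Proof. by elim/quotW=> u; rewrite presmod_scaleE scale1r. Qed.
Fact presmod_scaleDr : right_distributive presmod_scale +%R.
Proof.
move=> a; elim/quotW=> u; elim/quotW=> v.
by rewrite presmod_piD !presmod_scaleE presmod_piD scalerDr.
Qed.
Fact presmod_scaleDl u : {morph presmod_scale^~ u : a b / a + b}.
Proof.
by move=> a b; elim/quotW: u => u; rewrite !presmod_scaleE presmod_piD scalerDl.
Qed.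
HB.instance Definition _ := GRing.Zmodule_isLmodule.Build k presmod
  presmod_scaleA presmod_scale1 presmod_scaleDr presmod_scaleDl.

Definition presmod_pi (g : {malg k[X]}) : presmod := \pi_presmod g.
Fact presmod_pi_is_linear : linear presmod_pi.
Proof.
move=> a g h; rewrite /presmod_pi -presmod_addE; congr (presmod_add _ _).
by rewrite -presmod_scaleE.
Qed.
HB.instance Definition _ :=
  GRing.isLinear.Build k {malg k[X]} presmod *:%R presmod_pi presmod_pi_is_linear.

End PresentationModule.

HB.lock Definition gen (k : fieldType) (X : choiceType)
  (R : {malg k[X]} -> Prop) (x : X) : presmod R := presmod_pi R << x >>.

Section PresentationTheory.
Variables (k : fieldType) (X : choiceType) (R : {malg k[X]} -> Prop).
Local Notation presmod := (presmod R).
Local Notation relspan := (relspan R).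
Local Notation presmod_pi := (presmod_pi R).
Local Notation gen := (gen R).

Lemma presmod_piP (u : presmod) : exists g, u = presmod_pi g.
Proof. by elim/quotW: u => g; exists g. Qed.

Lemma presmod_pi_rel r : R r -> presmod_pi r = 0.
Proof.
move=> Rr; rewrite -(linear0 presmod_pi); apply/presmod_eq.
by rewrite subr0; exact: relspan_rel.
Qed.

Lemma gen_linrel a x y z : R (<< x >> - a *: << y >> - << z >>) ->
  gen x = a *: gen y + gen z.
Proof.
rewrite unlock.
move=> /presmod_pi_rel/eqP; rewrite !linearB linearZ /= subr_eq0 subr_eq addrC.
by move=> /eqP.
Qed.

Lemma presmod_ind (P : presmod -> Prop) :
    P 0 -> (forall a u v, P u -> P v -> P (a *: u + v)) ->
  (forall x, P (gen x)) -> forall u, P u.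
Proof.
move=> P0 PL Pg u; have Pp x : P (presmod_pi << x >>) by have := Pg x; rewrite unlock.
have [g ->] := presmod_piP u.
rewrite [g]monalgE raddf_sum /=.
apply: (big_ind P) => // [v w Pv Pw|x _].
  by rewrite -[v]scale1r; apply: PL.
have -> : << g@_x *g x >> = g@_x *: << x >> :> {malg k[X]}.
  by apply/malgP => y; rewrite mcoeffZ !mcoeffU mulrnAr mulr1.
by rewrite linearZ -[X in P X]addr0; apply: PL => //; apply: Pp.
Qed.

Section Lift.
Variables (W : lmodType k) (f : X -> W).
Hypothesis fR : forall r, R r -> linext f r = 0.

Lemma linext_relspan g : relspan g -> linext f g = 0.
Proof.
elim=> [|a r h Rr _ IH]; first exact: linear0.
by rewrite linearP /= fR // IH scaler0 addr0.
Qed.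

Definition presmod_lift (u : presmod) : W := linext f (repr u).

Lemma presmod_lift_pi g : presmod_lift (presmod_pi g) = linext f g.
Proof.
by apply/eqP; rewrite -subr_eq0 -linearB /= linext_relspan //; exact: presmod_repr.
Qed.

Lemma presmod_lift_is_linear : linear presmod_lift.
Proof.
move=> a u v; have [g ->] := presmod_piP u; have [h ->] := presmod_piP v.
by rewrite -linearP !presmod_lift_pi linearP.
Qed.

Lemma presmod_lift_gen x : presmod_lift (gen x) = f x.
Proof. by rewrite unlock presmod_lift_pi linextU. Qed.
End Lift.

End PresentationTheory.

Section Bilift.
Variables (k : fieldType) (X Y : choiceType) (W : lmodType k).
Variables (R : {malg k[X]} -> Prop) (S : {malg k[Y]} -> Prop) (f : X -> Y -> W).
Hypothesis fR : forall y r, R r -> linext (f^~ y) r = 0.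
Hypothesis fS : forall x s, S s -> linext (f x) s = 0.

Definition presmod_bilift (u : presmod R) (v : presmod S) : W :=
  presmod_lift (fun x => presmod_lift (f x) v) u.

Let liftR (v : presmod S) r : R r -> linext (fun x => presmod_lift (f x) v) r = 0.
Proof.
move=> Rr; have [h ->] := presmod_piP v; rewrite /linext.
under eq_bigr => x _ do rewrite (presmod_lift_pi (fS x)) /linext scaler_sumr.
rewrite exchange_big /= big1 // => y _.
under eq_bigr => x _ do rewrite scalerA mulrC -scalerA.
by rewrite -scaler_sumr -[X in _ *: X]/(linext (f^~ y) r) fR // scaler0.
Qed.

Lemma presmod_bilift_is_bilinear : bilin presmod_bilift.
Proof.
split=> [v a u u'|u a v v']; first exact: (presmod_lift_is_linear (liftR v)).
have [g ->] := presmod_piP u; rewrite /presmod_bilift !(presmod_lift_pi (liftR _)).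
rewrite /linext scaler_sumr -big_split /=; apply: eq_bigr => x _.
by rewrite (presmod_lift_is_linear (fS x)) scalerDr !scalerA mulrC.
Qed.

Lemma presmod_bilift_gen x y : presmod_bilift (gen R x) (gen S y) = f x y.
Proof. by rewrite /presmod_bilift (presmod_lift_gen (liftR _)) (presmod_lift_gen (fS x)). Qed.
End Bilift.

Section Tensor.
Variables (k : fieldType) (U V : lmodType k).

Variant tens_rel : {malg k[(U * V)%type]} -> Prop :=
  | TensRelL a (u u' : U) (v : V) :
      tens_rel (<< (a *: u + u', v) >> - a *: << (u, v) >> - << (u', v) >>)
  | TensRelR a (u : U) (v v' : V) :
      tens_rel (<< (u, a *: v + v') >> - a *: << (u, v) >> - << (u, v') >>).

Definition tens := presmod tens_rel.
HB.instance Definition _ := GRing.Lmodule.on tens.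

End Tensor.

HB.lock Definition pure (k : fieldType) (U V : lmodType k) (u : U) (v : V) :
  tens U V := gen (@tens_rel k U V) (u, v).
Arguments pure {k U V}.

Section TensorTheory.
Variables (k : fieldType) (U V : lmodType k).
Local Notation pure := (@pure k U V).
Local Notation tens := (tens U V).
Local Notation tens_rel := (@tens_rel k U V).

Lemma pure_gen u v : pure u v = gen tens_rel (u, v).
Proof. by rewrite unlock. Qed.

Lemma pure_bilin : bilin pure.
Proof.
rewrite unlock; split=> [v a u u'|u a v v'].
  exact: (gen_linrel (TensRelL a u u' v)).
exact: (gen_linrel (TensRelR a u v v')).
Qed.

Lemma tens_ind (P : tens -> Prop) :
    P 0 -> (forall a s t, P s -> P t -> P (a *: s + t)) ->
  (forall u v, P (pure u v)) -> forall t, P t.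
Proof. by rewrite unlock => P0 PL Pp; apply: presmod_ind => // -[u v]; apply: Pp. Qed.

Section TensLift.
Variables (W : lmodType k) (f : U -> V -> W).
Hypothesis f_bilin : bilin f.

Fact tens_lift_rel r : tens_rel r -> linext (fun p => f p.1 p.2) r = 0.
Proof.
case=> [a u u' v|a u v v']; rewrite !linearB linearZ /= !linextU /=.
  by rewrite f_bilin.1 addrAC addrK subrr.
by rewrite f_bilin.2 addrAC addrK subrr.
Qed.

Definition tlift of bilin f : tens -> W := presmod_lift (fun p => f p.1 p.2).

Fact tlift_is_linear : linear (tlift f_bilin).
Proof. exact: presmod_lift_is_linear tens_lift_rel. Qed.
HB.instance Definition _ :=
  GRing.isLinear.Build k tens W *:%R (tlift f_bilin) tlift_is_linear.

Lemma tliftP a s t :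
  tlift f_bilin (a *: s + t) = a *: tlift f_bilin s + tlift f_bilin t.
Proof. exact: tlift_is_linear. Qed.

Lemma tliftE u v : tlift f_bilin (pure u v) = f u v.
Proof. by rewrite unlock; exact: (presmod_lift_gen tens_lift_rel). Qed.
End TensLift.

End TensorTheory.

Notation "u ⊗ v" := (pure u v) : ring_scope.

Lemma pureDl (k : fieldType) (U V : lmodType k) (u u' : U) (v : V) :
  (u + u') ⊗ v = u ⊗ v + u' ⊗ v.
Proof. by have := (pure_bilin U V).1 v 1 u u'; rewrite !scale1r. Qed.
Lemma pureDr (k : fieldType) (U V : lmodType k) (u : U) (v v' : V) :
  u ⊗ (v + v') = u ⊗ v + u ⊗ v'.
Proof. by have := (pure_bilin U V).2 u 1 v v'; rewrite !scale1r. Qed.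
Lemma pure0l (k : fieldType) (U V : lmodType k) (v : V) : (0 : U) ⊗ v = 0.
Proof. by apply: (addrI (0 ⊗ v)); rewrite -pureDl !addr0. Qed.
Lemma pure0r (k : fieldType) (U V : lmodType k) (u : U) : u ⊗ (0 : V) = 0.
Proof. by apply: (addrI (u ⊗ 0)); rewrite -pureDr !addr0. Qed.
Lemma pureZl (k : fieldType) (U V : lmodType k) a (u : U) (v : V) :
  (a *: u) ⊗ v = a *: (u ⊗ v).
Proof. by have := (pure_bilin U V).1 v a u 0; rewrite pure0l !addr0. Qed.
Lemma pureZr (k : fieldType) (U V : lmodType k) a (u : U) (v : V) :
  u ⊗ (a *: v) = a *: (u ⊗ v).
Proof. by have := (pure_bilin U V).2 u a v 0; rewrite pure0r !addr0. Qed.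
Lemma pureN1l (k : fieldType) (U V : lmodType k) (u : U) (v : V) :
  (- u) ⊗ v = - (u ⊗ v).
Proof. by rewrite -scaleN1r pureZl scaleN1r. Qed.
Definition pureE := (pureDl, pureDr, pureZl, pureZr, pure0l, pure0r).

Section TensorMaps.
Variables (k : fieldType).

Section Map.
Variables (U U' V V' : lmodType k).
Variables (f : {linear U -> U'}) (g : {linear V -> V'}).
Fact tmap_bilin : bilin (fun u v => f u ⊗ g v).
Proof. by split=> [v a u u'|u a v v'] /=; rewrite linearP !pureE. Qed.
Definition tmap : tens U V -> tens U' V' := tlift tmap_bilin.
HB.instance Definition _ := GRing.isLinear.Build k (tens U V) (tens U' V') *:%R
  tmap (tlift_is_linear tmap_bilin).
Lemma tmapE u v : tmap (u ⊗ v) = f u ⊗ g v.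
Proof. exact: tliftE. Qed.
End Map.

Section Assoc.
Variables (U V W : lmodType k).
Fact tassoc1_bilin w : bilin (fun (u : U) (v : V) => u ⊗ (v ⊗ (w : W))).
Proof. by split=> [v a u u'|u a v v'] /=; rewrite !pureE. Qed.
Fact tassoc_bilin : bilin (fun s w => tlift (tassoc1_bilin w) s).
Proof.
split=> [w a s t|s a w w'] /=; first exact: linearP.
elim/tens_ind: s => [|b s t IHs IHt|u v]; first by rewrite !linear0 ?scaler0 addr0.
  by rewrite !tliftP IHs IHt !scalerDr !scalerA mulrC addrACA.
by rewrite !tliftE !pureE.
Qed.
Definition tassoc : tens (tens U V) W -> tens U (tens V W) :=
  tlift tassoc_bilin.
HB.instance Definition _ := GRing.isLinear.Build k (tens (tens U V) W) (tens U (tens V W)) *:%R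
  tassoc (tlift_is_linear tassoc_bilin).
Lemma tassocE u v w : tassoc (u ⊗ v ⊗ w) = u ⊗ (v ⊗ w).
Proof. exact: (etrans (tliftE tassoc_bilin _ _) (tliftE (tassoc1_bilin w) _ _)). Qed.
End Assoc.

Section Contract.
Variables (U V : lmodType k).
Fact tscalel_bilin (f : {scalar U}) : bilin (fun u (v : V) => f u *: v).
Proof.
split=> [v a u u'|u a v v'] /=; first by rewrite linearP scalerDl scalerA.
by rewrite scalerDr !scalerA mulrC.
Qed.
Definition tscalel f : tens U V -> V := tlift (tscalel_bilin f).
HB.instance Definition _ f := GRing.isLinear.Build k (tens U V) V *:%R
  (tscalel f) (tlift_is_linear (tscalel_bilin f)).
Lemma tscalelE f u v : tscalel f (u ⊗ v) = f u *: v.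
Proof. exact: (tliftE (tscalel_bilin f)). Qed.
Fact tscaler_bilin (g : {scalar V}) : bilin (fun (u : U) v => g v *: u).
Proof.
split=> [v a u u'|u a v v'] /=; last by rewrite linearP scalerDl scalerA.
by rewrite scalerDr !scalerA mulrC.
Qed.
Definition tscaler g : tens U V -> U := tlift (tscaler_bilin g).
HB.instance Definition _ g := GRing.isLinear.Build k (tens U V) U *:%R
  (tscaler g) (tlift_is_linear (tscaler_bilin g)).
Lemma tscalerE g u v : tscaler g (u ⊗ v) = g v *: u.
Proof. exact: (tliftE (tscaler_bilin g)). Qed.
End Contract.

End TensorMaps.

Arguments tmap {k U U' V V'} f g.
Arguments tassoc {k} U V W.
Arguments tscalel {k U} V f.
Arguments tscaler {k} U {V} g.

(* MathComp has no non-unital algebras, and [GRing.Algebra] requires [1 != 0];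
   here an algebra need not be unital, and a unital algebra may be zero. *)
HB.mixin Record Lmodule_isAssocAlgebra (k : fieldType) A of GRing.Lmodule k A := {
  amul : A -> A -> A;
  amulA : associative amul;
  amul_bilin : bilin amul
}.
#[short(type="assocAlgType")]
HB.structure Definition AssocAlgebra (k : fieldType) :=
  {A of GRing.Lmodule k A & Lmodule_isAssocAlgebra k A}.
Notation "x ⋅ y" := (amul x y) : ring_scope.

HB.mixin Record AssocAlgebra_isUnital (k : fieldType) A of AssocAlgebra k A := {
  aone : A;
  amul1l : left_id aone (@amul k A);
  amul1r : right_id aone (@amul k A)
}.
#[short(type="uAlgType")]
HB.structure Definition UnitalAlgebra (k : fieldType) :=
  {A of AssocAlgebra k A & AssocAlgebra_isUnital k A}.
Arguments aone {k s}.

Section AssocAlgebraTheory.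
Variables (k : fieldType) (A : assocAlgType k).
Implicit Types (a : k) (x y z : A).
Lemma amulPl a x y z : (a *: x + y) ⋅ z = a *: (x ⋅ z) + y ⋅ z.
Proof. exact: amul_bilin.1. Qed.
Lemma amulPr a x y z : z ⋅ (a *: x + y) = a *: (z ⋅ x) + z ⋅ y.
Proof. exact: amul_bilin.2. Qed.
Lemma amulDl x y z : (x + y) ⋅ z = x ⋅ z + y ⋅ z.
Proof. by have := amulPl 1 x y z; rewrite !scale1r. Qed.
Lemma amulDr x y z : z ⋅ (x + y) = z ⋅ x + z ⋅ y.
Proof. by have := amulPr 1 x y z; rewrite !scale1r. Qed.
Lemma amul0l x : 0 ⋅ x = 0.
Proof. by apply: (addrI (0 ⋅ x)); rewrite -amulDl !addr0. Qed.
Lemma amul0r x : x ⋅ 0 = 0.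
Proof. by apply: (addrI (x ⋅ 0)); rewrite -amulDr !addr0. Qed.
Lemma amulZl a x y : (a *: x) ⋅ y = a *: (x ⋅ y).
Proof. by have := amulPl a x 0 y; rewrite amul0l !addr0. Qed.
Lemma amulZr a x y : x ⋅ (a *: y) = a *: (x ⋅ y).
Proof. by have := amulPr a y 0 x; rewrite amul0r !addr0. Qed.
Lemma amulNl x y : (- x) ⋅ y = - (x ⋅ y).
Proof. by rewrite -scaleN1r amulZl scaleN1r. Qed.
Lemma amulNr x y : x ⋅ (- y) = - (x ⋅ y).
Proof. by rewrite -scaleN1r amulZr scaleN1r. Qed.
End AssocAlgebraTheory.

Definition monoid_map (k : fieldType) (A B : uAlgType k) (f : A -> B) : Prop :=
  f aone = aone /\ {morph f : x y / x ⋅ y}.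

HB.lock Definition tens_mul (k : fieldType) (A B : assocAlgType k)
    (s t : tens A B) : tens A B :=
  presmod_bilift (fun p q : A * B => (p.1 ⋅ q.1) ⊗ (p.2 ⋅ q.2)) s t.

Section TensorAlgebra.
Variables (k : fieldType) (A B : assocAlgType k).
Local Notation tmul := (@tens_mul k A B).

Let f (p q : A * B) := (p.1 ⋅ q.1) ⊗ (p.2 ⋅ q.2).

Fact tens_mul_relL q r : @tens_rel k A B r -> linext (f^~ q) r = 0.
Proof.
case=> [a u u' v|a u v v']; rewrite !linearB linearZ /= !linextU /f /=.
  by rewrite amulPl !pureE addrAC addrK subrr.
by rewrite amulPl !pureE addrAC addrK subrr.
Qed.

Fact tens_mul_relR p r : @tens_rel k A B r -> linext (f p) r = 0.
Proof.
case=> [a u u' v|a u v v']; rewrite !linearB linearZ /= !linextU /f /=.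
  by rewrite amulPr !pureE addrAC addrK subrr.
by rewrite amulPr !pureE addrAC addrK subrr.
Qed.

Lemma tens_mulE (x x' : A) (y y' : B) :
  tmul (x ⊗ y) (x' ⊗ y') = (x ⋅ x') ⊗ (y ⋅ y').
Proof.
rewrite tens_mul.unlock (pure_gen x y) (pure_gen x' y').
exact: (presmod_bilift_gen tens_mul_relL tens_mul_relR).
Qed.

Lemma tens_mulPl a s s' t : tmul (a *: s + s') t = a *: tmul s t + tmul s' t.
Proof.
rewrite tens_mul.unlock.
exact: (presmod_bilift_is_bilinear tens_mul_relL tens_mul_relR).1.
Qed.
Lemma tens_mulPr a s t t' : tmul s (a *: t + t') = a *: tmul s t + tmul s t'.
Proof.
rewrite tens_mul.unlock.
exact: (presmod_bilift_is_bilinear tens_mul_relL tens_mul_relR).2.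
Qed.
Lemma tens_mulDl : left_distributive tmul +%R.
Proof. by move=> s s' t; have := tens_mulPl 1 s s' t; rewrite !scale1r. Qed.
Lemma tens_mulDr : right_distributive tmul +%R.
Proof. by move=> s t t'; have := tens_mulPr 1 s t t'; rewrite !scale1r. Qed.
Lemma tens_mul0l s : tmul 0 s = 0.
Proof. by apply: (addrI (tmul 0 s)); rewrite -tens_mulDl !addr0. Qed.
Lemma tens_mul0r s : tmul s 0 = 0.
Proof. by apply: (addrI (tmul s 0)); rewrite -tens_mulDr !addr0. Qed.
Lemma tens_mulZl a s t : tmul (a *: s) t = a *: tmul s t.
Proof. by have := tens_mulPl a s 0 t; rewrite tens_mul0l !addr0. Qed.
Lemma tens_mulZr a s t : tmul s (a *: t) = a *: tmul s t.
Proof. by have := tens_mulPr a s t 0; rewrite tens_mul0r !addr0. Qed.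

Lemma tens_mulA : associative tmul.
Proof.
move=> s t w; elim/tens_ind: s => [|a s s' IHs IHs'|x y].
- by rewrite !tens_mul0l.
- by rewrite !tens_mulPl IHs IHs'.
elim/tens_ind: t => [|a s s' IHs IHs'|x' y'].
- by rewrite tens_mul0l !tens_mul0r tens_mul0l.
- by rewrite tens_mulPl !tens_mulPr tens_mulPl IHs IHs'.
elim/tens_ind: w => [|a s s' IHs IHs'|x'' y''].
- by rewrite !tens_mul0r.
- by rewrite !tens_mulPr IHs IHs'.
by rewrite !tens_mulE !amulA.
Qed.

Fact tens_mul_bilin : bilin tmul.
Proof. by split=> [t a s s'|s a t t']; rewrite ?tens_mulPl ?tens_mulPr. Qed.
HB.instance Definition _ := Lmodule_isAssocAlgebra.Build k (tens A B)
  tens_mulA tens_mul_bilin.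

Lemma pureM (x x' : A) (y y' : B) :
  (x ⊗ y) ⋅ (x' ⊗ y') = (x ⋅ x') ⊗ (y ⋅ y').
Proof. exact: tens_mulE. Qed.

End TensorAlgebra.

Section TensorUnitalAlgebra.
Variables (k : fieldType) (A B : uAlgType k).
Local Notation tmul := (@tens_mul k A B).

Lemma tens_mul1l : left_id (aone ⊗ aone) tmul.
Proof.
move=> s; elim/tens_ind: s => [|a s s' IHs IHs'|x y].
- by rewrite !tens_mul0r.
- by rewrite !tens_mulPr IHs IHs'.
by rewrite tens_mulE !amul1l.
Qed.

Lemma tens_mul1r : right_id (aone ⊗ aone) tmul.
Proof.
move=> s; elim/tens_ind: s => [|a s s' IHs IHs'|x y].
- by rewrite !tens_mul0l.
- by rewrite !tens_mulPl IHs IHs'.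
by rewrite tens_mulE !amul1r.
Qed.
HB.instance Definition _ := AssocAlgebra_isUnital.Build k (tens A B)
  tens_mul1l tens_mul1r.

Lemma tens1E : aone = aone ⊗ aone :> tens A B. Proof. by []. Qed.
End TensorUnitalAlgebra.

Section Multiplication.
Variables (k : fieldType) (A : assocAlgType k).
Definition tmult : tens A A -> A := tlift (@amul_bilin k A).
HB.instance Definition _ := GRing.isLinear.Build k (tens A A) (A) *:%R
  tmult (tlift_is_linear (@amul_bilin k A)).
Lemma tmultE x y : tmult (x ⊗ y) = x ⋅ y.
Proof. exact: (tliftE (@amul_bilin k A)). Qed.
End Multiplication.
Arguments tmult {k} A.

HB.mixin Record Lmodule_isCoalgebra (k : fieldType) C of GRing.Lmodule k C := {
  comul : {linear C -> tens C C};
  counit : {scalar C};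
  comulA : forall x : C,
    tassoc C C C (tmap comul idfun (comul x)) = tmap idfun comul (comul x);
  counitl : forall x : C, tscalel C counit (comul x) = x;
  counitr : forall x : C, tscaler C counit (comul x) = x
}.
#[short(type="coalgType")]
HB.structure Definition Coalgebra (k : fieldType) :=
  {C of GRing.Lmodule k C & Lmodule_isCoalgebra k C}.

HB.mixin Record UnitalAlgebra_Coalgebra_isBialgebra (k : fieldType) H
    of UnitalAlgebra k H & Coalgebra k H := {
  comul_monoid : monoid_map (@comul k H : H -> tens H H);
  counit1 : @counit k H aone = 1;
  counitM : {morph @counit k H : x y / x ⋅ y >-> x * y}
}.
#[short(type="bialgType")]
HB.structure Definition Bialgebra (k : fieldType) :=
  {H of UnitalAlgebra k H & Coalgebra k H & UnitalAlgebra_Coalgebra_isBialgebra k H}.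

HB.mixin Record Bialgebra_isHopf (k : fieldType) H of Bialgebra k H := {
  antipode : {linear H -> H};
  antipodel : forall x : H,
    tmult H (tmap antipode idfun (comul x)) = counit x *: aone;
  antipoder : forall x : H,
    tmult H (tmap idfun antipode (comul x)) = counit x *: aone
}.
#[short(type="hopfAlgType")]
HB.structure Definition HopfAlgebra (k : fieldType) :=
  {H of Bialgebra k H & Bialgebra_isHopf k H}.

Section Words.
Variables (k : fieldType) (A : assocAlgType k).

(* [QSh A] is spanned by words subject to linearity in each letter; the relators
   preserve length, so its underlying space is the direct sum of the A^{⊗n}. *)
Variant word_rel : {malg k[seq A]} -> Prop :=
  | WordRel (s t : seq A) c (a b : A) :
      word_rel (<< s ++ (c *: a + b) :: t >> - c *: << s ++ a :: t >>
                - << s ++ b :: t >>).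

Definition QSh := presmod word_rel.
HB.instance Definition _ := GRing.Lmodule.on QSh.
End Words.

HB.lock Definition word (k : fieldType) (A : assocAlgType k) (s : seq A) : QSh A :=
  gen (@word_rel k A) s.
Arguments word {k A}.

Definition multilin (k : fieldType) (A W : lmodType k) (f : seq A -> W) : Prop :=
  forall s t c a b,
    f (s ++ (c *: a + b) :: t) = c *: f (s ++ a :: t) + f (s ++ b :: t).

Section WordTheory.
Variables (k : fieldType) (A : assocAlgType k).
Local Notation word := (@word k A).

Lemma word_gen s : word s = gen (@word_rel k A) s.
Proof. by rewrite unlock. Qed.

Lemma word_multilin : multilin word.
Proof. by move=> s t c a b; rewrite !word_gen; exact: (gen_linrel (WordRel s t c a b)). Qed.

Lemma word_ind (P : QSh A -> Prop) :
    P 0 -> (forall a x y, P x -> P y -> P (a *: x + y)) ->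
  (forall s, P (word s)) -> forall x, P x.
Proof. by rewrite unlock => P0 PL Pw; apply: presmod_ind. Qed.

Section WordLift.
Variables (W : lmodType k) (f : seq A -> W).
Hypothesis f_multi : multilin f.

Fact word_lift_rel r : word_rel r -> linext f r = 0.
Proof.
case=> s t c a b; rewrite !linearB linearZ /= !linextU.
by rewrite f_multi addrAC addrK subrr.
Qed.

Definition wlift of multilin f : QSh A -> W := presmod_lift f.

Fact wlift_is_linear : linear (wlift f_multi).
Proof. exact: presmod_lift_is_linear word_lift_rel. Qed.
HB.instance Definition _ :=
  GRing.isLinear.Build k (QSh A) W *:%R (wlift f_multi) wlift_is_linear.

Lemma wliftE s : wlift f_multi (word s) = f s.
Proof. by rewrite unlock; exact: (presmod_lift_gen word_lift_rel). Qed.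
End WordLift.

Fact wcons_multilin a : multilin (fun s => word (a :: s)).
Proof. by move=> s t c b d; apply: (word_multilin (a :: s)). Qed.
Definition wcons (a : A) : QSh A -> QSh A := wlift (wcons_multilin a).
HB.instance Definition _ a := GRing.isLinear.Build k (QSh A) (QSh A) *:%R
  (wcons a) (wlift_is_linear (wcons_multilin a)).
Lemma wconsE a s : wcons a (word s) = word (a :: s).
Proof. exact: (wliftE (wcons_multilin a)). Qed.

Lemma wconsPl c a b x : wcons (c *: a + b) x = c *: wcons a x + wcons b x.
Proof.
elim/word_ind: x => [|d x y IHx IHy|s].
- by rewrite !linear0 ?scaler0 addr0.
- by rewrite !linearP /= IHx IHy !scalerDr !scalerA mulrC addrACA.
by rewrite !wconsE; apply: (word_multilin [::]).
Qed.

(* (a v) ⋆ (b w) = a (v ⋆ b w) + b (a v ⋆ w) + (a ⋅ b) (v ⋆ w) *)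
Fixpoint qsh (v w : seq A) {struct v} : QSh A :=
  if v is a :: v' then
    (fix qsh_cons (w : seq A) : QSh A :=
       if w is b :: w' then
         wcons a (qsh v' w) + wcons b (qsh_cons w') + wcons (a ⋅ b) (qsh v' w')
       else word v) w
  else word w.

Lemma qsh_nil w : qsh [::] w = word w. Proof. by []. Qed.
Lemma qshnil v : qsh v [::] = word v. Proof. by case: v. Qed.
Lemma qsh_cons a v b w :
  qsh (a :: v) (b :: w) =
  wcons a (qsh v (b :: w)) + wcons b (qsh (a :: v) w) + wcons (a ⋅ b) (qsh v w).
Proof. by []. Qed.

Lemma linDD c (x y x' y' x'' y'' : QSh A) :
  (c *: x + y) + (c *: x' + y') + (c *: x'' + y'') =
  c *: (x + x' + x'') + (y + y' + y'').
Proof. by rewrite !scalerDr (addrACA _ y) [LHS]addrACA. Qed.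

Lemma qsh_multilinl w : multilin (qsh^~ w).
Proof.
move=> s t c a b; elim: s w => [|e s IHs] w; elim: w => [|d w IHw].
- by rewrite !qshnil; apply: (word_multilin [::]).
- by rewrite !cat0s !qsh_cons IHw amulPl !wconsPl linearP linDD.
- by rewrite !qshnil; apply: (word_multilin (e :: s)).
- by rewrite !cat_cons !qsh_cons !IHs -!cat_cons IHw !linearP linDD.
Qed.

Lemma qsh_multilinr v : multilin (qsh v).
Proof.
move=> s t c a b; elim: v s => [|e v IHv] s; first exact: word_multilin.
elim: s => [|d s IHs]; rewrite ?cat0s ?cat_cons !qsh_cons.
- have E := IHv [::]; rewrite !cat0s in E.
  by rewrite E amulPr !wconsPl linearP linDD.
- by rewrite -!cat_cons !IHv IHs !linearP linDD.
Qed.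
End WordTheory.
Arguments wcons {k A} a.

HB.lock Definition qsh_mul (k : fieldType) (A : assocAlgType k)
  (x y : QSh A) : QSh A := presmod_bilift (@qsh k A) x y.

Section QuasiShuffle.
Variables (k : fieldType) (A : assocAlgType k).
Local Notation word := (@word k A).
Local Infix "⋆" := (@qsh_mul k A) (at level 40, left associativity).

Let relL (w : seq A) r := word_lift_rel (@qsh_multilinl k A w) (r := r).
Let relR (v : seq A) r := word_lift_rel (@qsh_multilinr k A v) (r := r).

Lemma qsh_mul_word v w : word v ⋆ word w = qsh v w.
Proof.
rewrite unlock (word_gen v) (word_gen w).
exact: (presmod_bilift_gen relL relR).
Qed.
Lemma qsh_mulPl a x x' y : (a *: x + x') ⋆ y = a *: (x ⋆ y) + x' ⋆ y.
Proof. by rewrite unlock; exact: (presmod_bilift_is_bilinear relL relR).1. Qed.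
Lemma qsh_mulPr a x y y' : x ⋆ (a *: y + y') = a *: (x ⋆ y) + x ⋆ y'.
Proof. by rewrite unlock; exact: (presmod_bilift_is_bilinear relL relR).2. Qed.
Lemma qsh_mulDl x y z : (x + y) ⋆ z = x ⋆ z + y ⋆ z.
Proof. by have := qsh_mulPl 1 x y z; rewrite !scale1r. Qed.
Lemma qsh_mulDr x y z : z ⋆ (x + y) = z ⋆ x + z ⋆ y.
Proof. by have := qsh_mulPr 1 z x y; rewrite !scale1r. Qed.
Lemma qsh_mul0l x : 0 ⋆ x = 0.
Proof. by apply: (addrI (0 ⋆ x)); rewrite -qsh_mulDl !addr0. Qed.
Lemma qsh_mul0r x : x ⋆ 0 = 0.
Proof. by apply: (addrI (x ⋆ 0)); rewrite -qsh_mulDr !addr0. Qed.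

Lemma qsh_mul1l : left_id (word [::]) (@qsh_mul k A).
Proof.
move=> x; elim/word_ind: x => [|a x y IHx IHy|s]; first exact: qsh_mul0r.
  by rewrite qsh_mulPr IHx IHy.
by rewrite qsh_mul_word.
Qed.
Lemma qsh_mul1r : right_id (word [::]) (@qsh_mul k A).
Proof.
move=> x; elim/word_ind: x => [|a x y IHx IHy|s]; first exact: qsh_mul0l.
  by rewrite qsh_mulPl IHx IHy.
by rewrite qsh_mul_word qshnil.
Qed.

Lemma qsh_mul_cons (a b : A) x y :
  wcons a x ⋆ wcons b y =
  wcons a (x ⋆ wcons b y) + wcons b (wcons a x ⋆ y) + wcons (a ⋅ b) (x ⋆ y).
Proof.
elim/word_ind: x => [|c x x' IHx IHx'|v].
- by rewrite !(linear0 (wcons a), qsh_mul0l, linear0 (wcons b), linear0 (wcons _)) !addr0.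
- by rewrite [wcons a _]linearP /= !qsh_mulPl IHx IHx' !linearP linDD.
elim/word_ind: y => [|c y y' IHy IHy'|w].
- by rewrite !(linear0 (wcons b), qsh_mul0r, linear0 (wcons a), linear0 (wcons _)) !addr0.
- by rewrite [wcons b _]linearP /= !qsh_mulPr IHy IHy' !linearP linDD.
by rewrite !wconsE !qsh_mul_word.
Qed.

Lemma qsh_mul_consr a b c x y z :
  wcons a x ⋆ (wcons b y ⋆ wcons c z) =
  wcons a (x ⋆ (wcons b y ⋆ wcons c z)) + wcons c (wcons a x ⋆ (wcons b y ⋆ z))
  + wcons b (wcons a x ⋆ (y ⋆ wcons c z)) + wcons (a ⋅ b) (x ⋆ (y ⋆ wcons c z))
  + wcons (a ⋅ c) (x ⋆ (wcons b y ⋆ z)) + wcons (b ⋅ c) (wcons a x ⋆ (y ⋆ z))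
  + wcons (a ⋅ (b ⋅ c)) (x ⋆ (y ⋆ z)).
Proof.
rewrite (qsh_mul_cons b c) !qsh_mulDr !(qsh_mul_cons a) !(linearD (wcons a)) /=.
by rewrite [LHS](AC (3*3*3) (1*4*7*5*2*3*6*8*9)).
Qed.

Lemma qsh_mul_consl a b c x y z :
  (wcons a x ⋆ wcons b y) ⋆ wcons c z =
  wcons a ((x ⋆ wcons b y) ⋆ wcons c z) + wcons c ((wcons a x ⋆ wcons b y) ⋆ z)
  + wcons b ((wcons a x ⋆ y) ⋆ wcons c z) + wcons (a ⋅ b) ((x ⋆ y) ⋆ wcons c z)
  + wcons (a ⋅ c) ((x ⋆ wcons b y) ⋆ z) + wcons (b ⋅ c) ((wcons a x ⋆ y) ⋆ z)
  + wcons (a ⋅ (b ⋅ c)) ((x ⋆ y) ⋆ z).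
Proof.
rewrite amulA (qsh_mul_cons a b) !qsh_mulDl.
rewrite !(fun a' x' => qsh_mul_cons a' c x' z) !(linearD (wcons c)) /=.
by rewrite [LHS](AC (3*3*3) (1*(2*5*8)*4*7*3*6*9)).
Qed.

Lemma qsh_mul_wordA u v w :
  word u ⋆ (word v ⋆ word w) = (word u ⋆ word v) ⋆ word w.
Proof.
elim: u v w => [|a u IHu] v w; first by rewrite !qsh_mul1l.
elim: v w => [|b v IHv] w; first by rewrite qsh_mul1l qsh_mul1r.
elim: w => [|c w IHw]; first by rewrite !qsh_mul1r.
move: (IHu (b :: v) (c :: w)) (IHu (b :: v) w) (IHu v (c :: w)) (IHu v w).
move: (IHv (c :: w)) (IHv w) IHw => {IHu IHv}; rewrite -!wconsE.
by rewrite qsh_mul_consr qsh_mul_consl => -> -> -> -> -> -> ->.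
Qed.

Lemma qsh_mulA : associative (@qsh_mul k A).
Proof.
move=> x y z; elim/word_ind: x => [|a x x' IHx IHx'|u].
- by rewrite !qsh_mul0l.
- by rewrite !qsh_mulPl IHx IHx'.
elim/word_ind: y => [|a x x' IHx IHx'|v].
- by rewrite qsh_mul0l !qsh_mul0r qsh_mul0l.
- by rewrite qsh_mulPl !qsh_mulPr qsh_mulPl IHx IHx'.
elim/word_ind: z => [|a x x' IHx IHx'|w].
- by rewrite !qsh_mul0r.
- by rewrite !qsh_mulPr IHx IHx'.
exact: qsh_mul_wordA.
Qed.

Fact qsh_mul_bilin : bilin (@qsh_mul k A).
Proof. by split=> [y a x x'|x a y y']; rewrite ?qsh_mulPl ?qsh_mulPr. Qed.

HB.instance Definition _ := Lmodule_isAssocAlgebra.Build k (QSh A)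
  qsh_mulA qsh_mul_bilin.
HB.instance Definition _ := AssocAlgebra_isUnital.Build k (QSh A)
  qsh_mul1l qsh_mul1r.

Lemma qshM_word v w : word v ⋅ word w = qsh v w.
Proof. exact: qsh_mul_word. Qed.
Lemma qshM_cons (a b : A) (x y : QSh A) :
  wcons a x ⋅ wcons b y =
  wcons a (x ⋅ wcons b y) + wcons b (wcons a x ⋅ y) + wcons (a ⋅ b) (x ⋅ y).
Proof. exact: qsh_mul_cons. Qed.
Lemma qsh1E : aone = word [::] :> QSh A. Proof. by []. Qed.
End QuasiShuffle.

Section Deconcatenation.
Variables (k : fieldType) (A : assocAlgType k).
Local Notation word := (@word k A).
Local Notation wcons := (@wcons k A).

Definition deconc (s : seq A) : tens (QSh A) (QSh A) :=
  \sum_(r < (size s).+1) word (take r s) ⊗ word (drop r s).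

Local Notation P a := (tmap (wcons a) (idfun : {linear QSh A -> QSh A})).

Lemma deconc_nil : deconc [::] = word [::] ⊗ word [::].
Proof. by rewrite /deconc big_ord1. Qed.

Lemma deconc_cons a s :
  deconc (a :: s) = word [::] ⊗ word (a :: s) + P a (deconc s).
Proof.
rewrite /deconc big_ord_recl take0 drop0 linear_sum /=; congr (_ + _).
by apply: eq_bigr => i _; rewrite tmapE /= wconsE.
Qed.

Lemma tmap_wconsPl c a b X : P (c *: a + b) X = c *: P a X + P b X.
Proof.
elim/tens_ind: X => [|d x y IHx IHy|u v].
- by rewrite !linear0 ?scaler0 addr0.
- by rewrite !linearP /= IHx IHy !scalerDr !scalerA mulrC addrACA.
by rewrite !tmapE /= wconsPl !pureE.
Qed.

Lemma deconc_multilin : multilin deconc.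
Proof.
move=> s t c a b; elim: s => [|d s IHs]; rewrite ?cat0s ?cat_cons !deconc_cons.
- have E := word_multilin [::] t c a b; rewrite !cat0s in E.
  by rewrite E tmap_wconsPl !pureE scalerDr addrACA.
- rewrite IHs linearP -!cat_cons (word_multilin (d :: s)) !pureE scalerDr.
  by rewrite addrACA.
Qed.

Definition qsh_comul : QSh A -> tens (QSh A) (QSh A) := wlift deconc_multilin.
HB.instance Definition _ :=
  GRing.isLinear.Build k (QSh A) (tens (QSh A) (QSh A)) *:%R
    qsh_comul (wlift_is_linear deconc_multilin).
Lemma qsh_comulE s : qsh_comul (word s) = deconc s.
Proof. exact: (wliftE deconc_multilin). Qed.

Fact nilp_multilin : multilin (fun s : seq A => (nilp s)%:R : k^o).
Proof.
move=> s t c a b; have N x : nilp (s ++ x :: t) = false by case: s.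
by rewrite !N scaler0 addr0.
Qed.
Definition qsh_counit (x : QSh A) : k := wlift nilp_multilin x.
Fact qsh_counit_is_scalar : scalar qsh_counit.
Proof. exact: (wlift_is_linear nilp_multilin). Qed.
HB.instance Definition _ :=
  GRing.isLinear.Build k (QSh A) k *%R qsh_counit qsh_counit_is_scalar.
Lemma qsh_counitE s : qsh_counit (word s) = (nilp s)%:R.
Proof. exact: (wliftE nilp_multilin). Qed.

Lemma qsh_comul_cons a x :
  qsh_comul (wcons a x) = word [::] ⊗ wcons a x + P a (qsh_comul x).
Proof.
elim/word_ind: x => [|c x y IHx IHy|s].
- by rewrite !linear0 pure0r addr0.
- by rewrite !linearP /= IHx IHy !pureE scalerDr addrACA.
by rewrite wconsE !qsh_comulE deconc_cons.
Qed.

Lemma qsh_counit_cons a x : qsh_counit (wcons a x) = 0.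
Proof.
elim/word_ind: x => [|c x y IHx IHy|s]; first by rewrite !linear0.
  by rewrite !linearP /= IHx IHy mulr0 addr0.
by rewrite wconsE qsh_counitE.
Qed.

Lemma tassoc_wcons a y (Z : tens (QSh A) (QSh A)) :
  tassoc (QSh A) (QSh A) (QSh A) (P a Z ⊗ y) =
  tmap (wcons a) idfun (tassoc (QSh A) (QSh A) (QSh A) (Z ⊗ y)).
Proof.
elim/tens_ind: Z => [|c s t IHs IHt|u v].
- by rewrite !linear0 !pure0l !linear0.
- by rewrite !(linearP, pureE) /= IHs IHt.
by rewrite tassocE !tmapE /= tassocE.
Qed.

Lemma tassoc_comul_wcons a X :
  tassoc _ _ _ (tmap qsh_comul idfun (P a X)) =
  word [::] ⊗ P a X +
  tmap (wcons a) idfun (tassoc _ _ _ (tmap qsh_comul idfun X)).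
Proof.
elim/tens_ind: X => [|c s t IHs IHt|u v].
- by rewrite !linear0 pure0r addr0.
- by rewrite !(linearP, pureE) /= IHs IHt scalerDr addrACA.
by rewrite !tmapE /= qsh_comul_cons pureDl linearD /= tassocE tassoc_wcons.
Qed.

Lemma tmap_wcons_comul a X :
  tmap idfun qsh_comul (P a X) = tmap (wcons a) idfun (tmap idfun qsh_comul X).
Proof.
elim/tens_ind: X => [|c s t IHs IHt|u v].
- by rewrite !linear0.
- by rewrite !linearP /= IHs IHt.
by rewrite !tmapE /=.
Qed.

Lemma qsh_comulA x :
  tassoc _ _ _ (tmap qsh_comul idfun (qsh_comul x)) =
  tmap idfun qsh_comul (qsh_comul x).
Proof.
elim/word_ind: x => [|c x y IHx IHy|s]; first by rewrite !linear0.
  by rewrite !linearP /= IHx IHy.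
elim: s => [|a s IHs].
  by rewrite !qsh_comulE deconc_nil !tmapE /= !qsh_comulE deconc_nil tassocE.
rewrite -wconsE qsh_comul_cons !linearD /= tassoc_comul_wcons IHs.
rewrite tmap_wcons_comul !tmapE /= qsh_comulE deconc_nil tassocE qsh_comul_cons.
by rewrite pureDr addrA.
Qed.

Lemma qsh_counitl x : tscalel (QSh A) qsh_counit (qsh_comul x) = x.
Proof.
elim/word_ind: x => [|c x y IHx IHy|s]; first by rewrite !linear0.
  by rewrite !linearP /= IHx IHy.
have PE a X : tscalel (QSh A) qsh_counit (P a X) = 0.
  elim/tens_ind: X => [|c u v IHu IHv|u v]; first by rewrite !linear0.
    by rewrite !linearP /= IHu IHv scaler0 addr0.
  by rewrite tmapE /= tscalelE /= qsh_counit_cons scale0r.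
case: s => [|a s]; rewrite qsh_comulE ?deconc_nil ?deconc_cons.
  by rewrite tscalelE /= qsh_counitE scale1r.
by rewrite linearD /= PE tscalelE /= qsh_counitE scale1r addr0.
Qed.

Lemma qsh_counitr x : tscaler (QSh A) qsh_counit (qsh_comul x) = x.
Proof.
elim/word_ind: x => [|c x y IHx IHy|s]; first by rewrite !linear0.
  by rewrite !linearP /= IHx IHy.
have PE a X : tscaler (QSh A) qsh_counit (P a X) =
              wcons a (tscaler (QSh A) qsh_counit X).
  elim/tens_ind: X => [|c u v IHu IHv|u v]; first by rewrite !linear0.
    by rewrite !linearP /= IHu IHv.
  by rewrite tmapE /= !tscalerE /= linearZ.
elim: s => [|a s]; rewrite !qsh_comulE ?deconc_nil ?deconc_cons.
  by rewrite tscalerE /= qsh_counitE scale1r.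
by move=> IHs; rewrite linearD /= PE IHs tscalerE /= qsh_counitE scale0r add0r wconsE.
Qed.

HB.instance Definition _ := Lmodule_isCoalgebra.Build k (QSh A)
  qsh_comulA qsh_counitl qsh_counitr.

Lemma tmap_wconsM a b X Y :
  P a X ⋅ P b Y = P a (X ⋅ P b Y) + P b (P a X ⋅ Y) + P (a ⋅ b) (X ⋅ Y).
Proof.
have L c (x y x' y' x'' y'' : tens (QSh A) (QSh A)) :
  (c *: x + y) + (c *: x' + y') + (c *: x'' + y'') =
  c *: (x + x' + x'') + (y + y' + y'').
  by rewrite !scalerDr (addrACA _ y) [LHS]addrACA.
elim/tens_ind: X => [|c X X' IHX IHX'|u v].
- by rewrite !(linear0 (P a), amul0l, linear0 (P b), linear0 (P _)) !addr0.
- by rewrite [P a _]linearP /= !amulPl IHX IHX' !linearP L.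
elim/tens_ind: Y => [|c Y Y' IHY IHY'|u' v'].
- by rewrite !(linear0 (P b), amul0r, linear0 (P a), linear0 (P _)) !addr0.
- by rewrite [P b _]linearP /= !amulPr IHY IHY' !linearP L.
by rewrite !tmapE /= !pureM !tmapE /= qshM_cons !pureE.
Qed.

Lemma tmap_wcons1l a (w : QSh A) Y :
  (word [::] ⊗ w) ⋅ P a Y = P a ((word [::] ⊗ w) ⋅ Y).
Proof.
elim/tens_ind: Y => [|c Y Y' IHY IHY'|u v].
- by rewrite linear0 !amul0r linear0.
- by rewrite linearP /= !amulPr linearP /= IHY IHY'.
by rewrite tmapE /= !pureM tmapE /= !amul1l.
Qed.

Lemma tmap_wcons1r a (w : QSh A) X :
  P a X ⋅ (word [::] ⊗ w) = P a (X ⋅ (word [::] ⊗ w)).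
Proof.
elim/tens_ind: X => [|c Y Y' IHY IHY'|u v].
- by rewrite linear0 !amul0l linear0.
- by rewrite linearP /= !amulPl linearP /= IHY IHY'.
by rewrite tmapE /= !pureM tmapE /= !amul1r.
Qed.

Lemma qsh_comulM (x y : QSh A) :
  qsh_comul (x ⋅ y) = qsh_comul x ⋅ qsh_comul y.
Proof.
elim/word_ind: x => [|c x x' IHx IHx'|v].
- by rewrite amul0l !linear0 amul0l.
- by rewrite amulPl !linearP /= amulPl IHx IHx'.
elim/word_ind: y => [|c x x' IHx IHx'|w].
- by rewrite amul0r !linear0 amul0r.
- by rewrite amulPr !linearP /= amulPr IHx IHx'.
have E1 : qsh_comul (word [::]) = aone by rewrite qsh_comulE deconc_nil.
elim: v w => [|a v IHv] w; first by rewrite E1 !amul1l.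
elim: w => [|b w IHw]; first by rewrite E1 !amul1r.
move: (IHv (b :: w)) (IHv w) IHw => {IHv}; rewrite -!wconsE.
move: (word v) (word w) => x y E2 E3 E4.
rewrite qshM_cons !linearD /= !qsh_comul_cons E2 E3 E4.
rewrite !qsh_comul_cons !amulDl !amulDr tmap_wconsM tmap_wcons1l !tmap_wcons1r.
rewrite pureM amul1l qshM_cons !pureDr !linearD /=.
by rewrite [LHS](AC ((1*2)*(1*2)*2) (((1*4*7)*5)*(2*(3*6*8)))).
Qed.

Lemma qsh_comul_monoid : monoid_map (qsh_comul : QSh A -> tens (QSh A) (QSh A)).
Proof. by split; [rewrite qsh_comulE deconc_nil | exact: qsh_comulM]. Qed.

Lemma qsh_counitM : {morph qsh_counit : x y / x ⋅ y >-> x * y}.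
Proof.
move=> x y; elim/word_ind: x => [|c x x' IHx IHx'|v].
- by rewrite amul0l !linear0 mul0r.
- by rewrite amulPl !linearP /= IHx IHx' mulrDl mulrA.
elim/word_ind: y => [|c x x' IHx IHx'|w].
- by rewrite amul0r !linear0 mulr0.
- by rewrite amulPr !linearP /= IHx IHx' mulrDr mulrCA.
case: v => [|a v]; first by rewrite amul1l !qsh_counitE mul1r.
case: w => [|b w]; first by rewrite amul1r !qsh_counitE mulr1.
by rewrite -!wconsE qshM_cons !linearD /= !qsh_counit_cons !addr0 mul0r.
Qed.

Lemma qsh_counit1 : qsh_counit aone = 1.
Proof. by rewrite qsh_counitE. Qed.

HB.instance Definition _ := UnitalAlgebra_Coalgebra_isBialgebra.Build k (QSh A)
  qsh_comul_monoid qsh_counit1 qsh_counitM.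

End Deconcatenation.
Arguments qsh_comul {k A}.
Arguments qsh_counit {k A}.

Section Antipode.
Variables (k : fieldType) (A : assocAlgType k).
Local Notation word := (@word k A).
Local Notation wcons := (@wcons k A).
Implicit Types (f g h : seq A -> QSh A).

(* Convolution, for deconcatenation, of maps defined on words only. *)
Fixpoint conv f g (s : seq A) : QSh A :=
  f [::] ⋅ g s + (if s is a :: s' then conv (fun t => f (a :: t)) g s' else 0).

Definition conv1 (s : seq A) : QSh A := (nilp s)%:R *: aone.

Lemma conv0l g s : conv (fun=> 0) g s = 0.
Proof. by elim: s => [|a s IHs] /=; rewrite amul0l ?IHs addr0. Qed.

Lemma conv1l g : conv conv1 g = g.
Proof.
apply: funext => s; case: s => [|a s] /=; rewrite /conv1 /= scale1r amul1l ?addr0 //.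
by under [fun t => _]funext => t do rewrite scale0r; rewrite conv0l addr0.
Qed.

Lemma conv1r f : conv f conv1 = f.
Proof.
apply: funext => s; elim: s f => [|a s IHs] f /=; rewrite /conv1 /=.
  by rewrite scale1r amul1r addr0.
by rewrite scale0r amul0r add0r IHs.
Qed.

Lemma convPl (x : QSh A) f f' g s :
  conv (fun t => x ⋅ f t + f' t) g s = x ⋅ conv f g s + conv f' g s.
Proof.
elim: s f f' => [|a s IHs] f f' /=.
  by rewrite !addr0 amulDl amulA.
by rewrite IHs amulDl amulDr amulA addrACA.
Qed.

Lemma convA f g h : conv f (conv g h) = conv (conv f g) h.
Proof.
apply: funext => s; elim: s f g h => [|a s IHs] f g h /=.
  by rewrite !addr0 amulA.
by rewrite convPl -IHs amulDr addr0 !amulA !addrA.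
Qed.

(* The convolution inverse of f when f [::] = 1: the sum over the factorizations
   s = s1 ... sl into nonempty words of (-1)^l f s1 ⋅ ... ⋅ f sl; in
   [conv_inv_aux f p s] the first factor starts with p and the sign is (-1)^(l-1). *)
Fixpoint conv_inv_aux f (p s : seq A) : QSh A :=
  if s is b :: s' then
    conv_inv_aux f (rcons p b) s' - f p ⋅ conv_inv_aux f [:: b] s'
  else f p.

Definition conv_inv f (s : seq A) : QSh A :=
  if s is b :: s' then - conv_inv_aux f [:: b] s' else aone.

Lemma conv_inv_auxE f p s :
  conv (fun t => f (p ++ t)) (conv_inv f) s = conv_inv_aux f p s.
Proof.
elim: s p => [|b s IHs] p /=; rewrite cats0 ?amul1r ?addr0 //.
rewrite -(IHs (rcons p b)) amulNr addrC; congr (conv _ _ _ - _).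
by apply: funext => t; rewrite cat_rcons.
Qed.

Lemma conv_invr f : f [::] = aone -> conv f (conv_inv f) = conv1.
Proof.
move=> f1; apply: funext => -[|b s] /=; rewrite f1 amul1l /conv1 /=.
  by rewrite addr0 scale1r.
by rewrite (conv_inv_auxE f [:: b]) addNr scale0r.
Qed.

Lemma conv_invl f : f [::] = aone -> conv (conv_inv f) f = conv1.
Proof.
move=> f1; have E := conv_invr f1.
have E' := @conv_invr (conv_inv f) erefl.
have {2}-> : f = conv_inv (conv_inv f) by rewrite -[LHS]conv1r -E' convA E conv1l.
exact: E'.
Qed.

Local Notation sant := (conv_inv word).

Fact conv_inv_aux_multilinl q s :
  multilin (fun p => conv_inv_aux word (p ++ q) s).
Proof.
move=> p t c a b; rewrite -!catA /=.
elim: s t q => [|d s IHs] t q /=; first exact: word_multilin.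
rewrite !rcons_cat /= !rcons_cat IHs word_multilin amulPl.
by rewrite scalerBr opprD addrACA.
Qed.

Fact conv_inv_aux_multilinr p : multilin (conv_inv_aux word p).
Proof.
move=> s t c a b; elim: s p => [|d s IHs] p /=.
  have E r := conv_inv_aux_multilinl [::] t r [::] c a b.
  move: (E p) (E [::]); rewrite /= !cats0 !cats1 => -> ->.
  by rewrite amulPr scalerBr opprD addrACA.
by rewrite !IHs amulPr scalerBr opprD addrACA.
Qed.

Fact sant_multilin : multilin sant.
Proof.
move=> [|d s] t c a b /=; last by rewrite conv_inv_aux_multilinr opprD scalerN.
have := conv_inv_aux_multilinl [::] t [::] [::] c a b.
by rewrite /= => ->; rewrite opprD scalerN.
Qed.

Definition qsh_antipode : QSh A -> QSh A := wlift sant_multilin.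
HB.instance Definition _ := GRing.isLinear.Build k (QSh A) (QSh A) *:%R
  qsh_antipode (wlift_is_linear sant_multilin).
Lemma qsh_antipodeE s : qsh_antipode (word s) = conv_inv word s.
Proof. exact: (wliftE sant_multilin). Qed.

Lemma convE (F G : {linear QSh A -> QSh A}) s :
  tmult (QSh A) (tmap F G (comul (word s))) =
  conv (fun t => F (word t)) (fun t => G (word t)) s.
Proof.
rewrite [comul _]qsh_comulE.
elim: s F => [|a s IHs] F /=; rewrite ?deconc_nil ?deconc_cons.
  by rewrite tmapE /= tmultE addr0.
rewrite !linearD /= tmapE /= tmultE; congr (_ + _).
have -> X : tmap F G (tmap (wcons a) idfun X) = tmap (F \o wcons a) G X.
  elim/tens_ind: X => [|c u v IHu IHv|u v]; first by rewrite !linear0.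
    by rewrite !linearP /= IHu IHv.
  by rewrite !tmapE /=.
rewrite IHs; congr (conv _ _ _); apply: funext => t /=.
by rewrite wconsE.
Qed.

Lemma qsh_antipodel (x : QSh A) :
  tmult (QSh A) (tmap qsh_antipode idfun (comul x)) = counit x *: aone.
Proof.
elim/word_ind: x => [|c x y IHx IHy|s].
- by rewrite !linear0 scale0r.
- by rewrite !linearP /= IHx IHy scalerDl scalerA.
rewrite convE [counit _]qsh_counitE.
transitivity (conv sant word s); last by rewrite conv_invl.
by congr (conv _ _ _); apply: funext => t; exact: qsh_antipodeE.
Qed.

Lemma qsh_antipoder (x : QSh A) :
  tmult (QSh A) (tmap idfun qsh_antipode (comul x)) = counit x *: aone.
Proof.
elim/word_ind: x => [|c x y IHx IHy|s].
- by rewrite !linear0 scale0r.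
- by rewrite !linearP /= IHx IHy scalerDl scalerA.
rewrite convE [counit _]qsh_counitE.
transitivity (conv word sant s); last by rewrite conv_invr.
by congr (conv _ _ _); apply: funext => t; exact: qsh_antipodeE.
Qed.

HB.instance Definition _ := Bialgebra_isHopf.Build k (QSh A)
  qsh_antipodel qsh_antipoder.
End Antipode.
Arguments qsh_antipode {k A}.

Section Homomorphisms.
Variable k : fieldType.

Record algHom (A B : uAlgType k) := AlgHom {
  alg_fun :> A -> B;
  alg_fun_linear : linear alg_fun;
  alg_fun_monoid : monoid_map alg_fun
}.
HB.instance Definition _ (A B : uAlgType k) (f : algHom A B) :=
  GRing.isLinear.Build k A B *:%R f (alg_fun_linear f).

Record hopfHom (H K : hopfAlgType k) := HopfHom {
  hopf_fun :> algHom H K;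
  hopf_comul : forall x, comul (hopf_fun x) = tmap hopf_fun hopf_fun (comul x);
  hopf_counit : forall x, counit (hopf_fun x) = counit x;
  hopf_antipode : forall x, hopf_fun (antipode x) = antipode (hopf_fun x)
}.

Lemma algHom_eq (A B : uAlgType k) (f g : algHom A B) : f =1 g -> f = g.
Proof.
case: f g => [f fL fM] [g gL gM] /= /funext E; case: _ / E gL gM => gL gM.
by congr AlgHom; apply: Prop_irrelevance.
Qed.

Lemma hopfHom_eq (H K : hopfAlgType k) (f g : hopfHom H K) : f =1 g -> f = g.
Proof.
case: f g => [f f1 f2 f3] [g g1 g2 g3] /= /algHom_eq E.
by case: _ / E g1 g2 g3 => *; congr HopfHom; apply: Prop_irrelevance.
Qed.

Section Comp.
Variables (A B C : uAlgType k) (g : algHom B C) (f : algHom A B).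
Fact alg_comp_linear : linear (g \o f). Proof. exact: linearP. Qed.
Fact alg_comp_monoid : monoid_map (g \o f).
Proof.
split=> [|x y] /=; first by rewrite (alg_fun_monoid f).1 (alg_fun_monoid g).1.
by rewrite (alg_fun_monoid f).2 (alg_fun_monoid g).2.
Qed.
Definition alg_comp : algHom A C := AlgHom alg_comp_linear alg_comp_monoid.
End Comp.

Section HopfComp.
Variables (H K L : hopfAlgType k) (g : hopfHom K L) (f : hopfHom H K).
Local Notation gf := (alg_comp g f).
Fact hopf_comp_comul x : comul (gf x) = tmap gf gf (comul x).
Proof.
rewrite /= hopf_comul hopf_comul; move: (comul x) => X.
elim/tens_ind: X => [|c u v IHu IHv|u v]; first by rewrite !linear0.
  by rewrite !linearP /= IHu IHv.
by rewrite !tmapE.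
Qed.
Fact hopf_comp_counit x : counit (gf x) = counit x.
Proof. by rewrite /= !hopf_counit. Qed.
Fact hopf_comp_antipode x : gf (antipode x) = antipode (gf x).
Proof. by rewrite /= !hopf_antipode. Qed.
Definition hopf_comp : hopfHom H L :=
  HopfHom hopf_comp_comul hopf_comp_counit hopf_comp_antipode.
End HopfComp.

Section QShMap.
Variables (A B : uAlgType k) (l : algHom A B).

Fact qsh_map_multilin : multilin (fun s : seq A => word (map l s)).
Proof. by move=> s t c a b; rewrite !map_cat /= linearP word_multilin. Qed.
Definition qsh_map_fun : QSh A -> QSh B := wlift qsh_map_multilin.
HB.instance Definition _ := GRing.isLinear.Build k (QSh A) (QSh B) *:%R
  qsh_map_fun (wlift_is_linear qsh_map_multilin).

Lemma qsh_map_word s : qsh_map_fun (word s) = word (map l s).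
Proof. exact: (wliftE qsh_map_multilin). Qed.

Lemma qsh_map_cons a x : qsh_map_fun (wcons a x) = wcons (l a) (qsh_map_fun x).
Proof.
elim/word_ind: x => [|c x y IHx IHy|s]; first by rewrite !linear0.
  by rewrite !linearP /= IHx IHy.
by rewrite wconsE !qsh_map_word wconsE.
Qed.

Fact qsh_map_mul : {morph qsh_map_fun : x y / x ⋅ y}.
Proof.
move=> x y; elim/word_ind: x => [|c x x' IHx IHx'|v].
- by rewrite amul0l !linear0 amul0l.
- by rewrite amulPl !linearP /= amulPl IHx IHx'.
elim/word_ind: y => [|c x x' IHx IHx'|w].
- by rewrite amul0r !linear0 amul0r.
- by rewrite amulPr !linearP /= amulPr IHx IHx'.
have E1 : qsh_map_fun (word [::]) = aone by rewrite qsh_map_word.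
elim: v w => [|a v IHv] w; first by rewrite E1 !amul1l.
elim: w => [|b w IHw]; first by rewrite E1 !amul1r.
move: (IHv (b :: w)) (IHv w) IHw; rewrite -!wconsE.
move: (word v) (word w) => x y E2 E3 E4.
rewrite qshM_cons !linearD /= !qsh_map_cons E2 E3 E4 !qsh_map_cons qshM_cons.
by rewrite (alg_fun_monoid l).2.
Qed.

Fact qsh_map_monoid : monoid_map qsh_map_fun.
Proof. by split; [rewrite qsh_map_word | exact: qsh_map_mul]. Qed.

Definition qsh_map_alg : algHom (QSh A) (QSh B) :=
  AlgHom (wlift_is_linear qsh_map_multilin : linear qsh_map_fun) qsh_map_monoid.

Fact qsh_map_comul x :
  comul (qsh_map_alg x) = tmap qsh_map_alg qsh_map_alg (comul x).
Proof.
rewrite -![comul _]/(qsh_comul _) /=.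
elim/word_ind: x => [|c x y IHx IHy|s]; first by rewrite !linear0.
  by rewrite !linearP /= IHx IHy.
rewrite qsh_map_word !qsh_comulE /deconc linear_sum size_map /=.
by apply: eq_bigr => i _; rewrite tmapE /= !qsh_map_word map_take map_drop.
Qed.

Fact qsh_map_counit x : counit (qsh_map_alg x) = counit x.
Proof.
rewrite -![counit _]/(qsh_counit _) /=.
elim/word_ind: x => [|c x y IHx IHy|s]; first by rewrite !linear0.
  by rewrite !linearP /= IHx IHy.
by rewrite qsh_map_word !qsh_counitE /nilp size_map.
Qed.

Fact qsh_map_antipode x : qsh_map_alg (antipode x) = antipode (qsh_map_alg x).
Proof.
rewrite -![antipode _]/(qsh_antipode _) /=.
elim/word_ind: x => [|c x y IHx IHy|s]; first by rewrite !linear0.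
  by rewrite !linearP /= IHx IHy.
have aux p t : qsh_map_fun (conv_inv_aux word p t) =
               conv_inv_aux word (map l p) (map l t).
  elim: t p => [|b t IHt] p /=; first exact: qsh_map_word.
  by rewrite linearB /= qsh_map_mul qsh_map_word !IHt map_rcons.
rewrite qsh_map_word !qsh_antipodeE; case: s => [|b s] /=.
  exact: qsh_map_word.
by rewrite linearN /= -(aux [:: b]).
Qed.

Definition qsh_map : hopfHom (QSh A) (QSh B) :=
  HopfHom qsh_map_comul qsh_map_counit qsh_map_antipode.
End QShMap.
End Homomorphisms.

Section Conilpotence.
Variables (k : fieldType).

(* The tensor power V^{⊗(n+1)}. *)
Fixpoint tpow (V : lmodType k) (n : nat) : lmodType k :=
  if n is m.+1 then tens V (tpow V m) else V.

Variable H : bialgType k.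

Definition redcomul (h : H) : tens H H := comul h - aone ⊗ h - h ⊗ aone.
Fact redcomul_is_linear : linear redcomul.
Proof.
move=> a x y; rewrite /redcomul linearP /= !pureE !scalerDr !opprD !scalerN.
by rewrite (AC ((2*2)*2) ((1*3*5)*(2*4*6))).
Qed.
HB.instance Definition _ :=
  GRing.isLinear.Build k H (tens H H) *:%R redcomul redcomul_is_linear.

(* [redcomul_iter n] is Δ'^{[n+1]}, extended from ker ε to H by the same formula
   and with values in H^{⊗(n+1)}; over a field (ker ε)^{⊗(n+1)} embeds there, so
   vanishing on ker ε does not depend on the codomain. *)
Fixpoint redcomul_iter (n : nat) : {linear H -> tpow H n} :=
  if n is m.+1 then tmap idfun (redcomul_iter m) \o redcomul else idfun.

Definition conilpotent : Prop :=
  forall h : H, counit h = 0 -> exists n, redcomul_iter n h = 0.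
End Conilpotence.
Arguments conilpotent {k} H.

(* Main.v *)
Require Import Defs.
From HB Require Import structures.
From mathcomp Require Import all_boot all_order all_algebra.
From mathcomp Require Import boolp.
Set Implicit Arguments.
Unset Strict Implicit.
Unset Printing Implicit Defensive.
Import GRing.Theory.
Local Open Scope ring_scope.

(** The map π : QSh(A) → A sending the empty word to 1, a one-letter word to its
    letter and longer words to 0 is a unital algebra map, and the bijection is the
    inverse of F ↦ π ∘ F.  A Hopf map F with π ∘ F = f satisfies
    F h = ε(h) 1 + Σ φ(h') · F(h''), where φ = f - ε 1 and · prepends a letter.
    Truncating words by length shows that this equation has at most one solution.
    Its iterates from ε 1 differ at step n through the n-fold reduced coproduct, so
    on a conilpotent H they stabilize pointwise.  That the limit respects products
    and coproducts is again uniqueness, by truncation, for equations of this shape. *)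

(** * Compatibility of bialgebra maps with antipodes *)

Section BialgebraMaps.
Variables (k : fieldType) (H K : hopfAlgType k) (F : {linear H -> K}).
Hypothesis F1 : F aone = aone.
Hypothesis FM : {morph F : x y / x ⋅ y}.
Hypothesis F_comul : forall x, comul (F x) = tmap F F (comul x).
Hypothesis F_counit : forall x, counit (F x) = counit x.

Definition convol (a b : {linear H -> K}) (x : H) : K := tmult K (tmap a b (comul x)).
HB.instance Definition _ a b :=
  GRing.Linear.copy (convol a b) (tmult K \o tmap a b \o comul).

Lemma convolA a b c : convol a (convol b c) =1 convol (convol a b) c.
Proof.
move=> x.
(* [m3] is the threefold product of [a], [b], [c]; it reduces associativity to coassociativity of
   [H] and [amulA]. *)
pose m3 : tens H (tens H H) -> K := tmult K \o tmap a (tmult K \o tmap b c).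
have -> : convol a (convol b c) x = m3 (tmap idfun comul (comul x)).
  rewrite /convol /m3 /=; move: (comul x) => X.
  elim/tens_ind: X => [|d s t IHs IHt|u v]; first by rewrite !linear0.
    by rewrite !linearP /= IHs IHt.
  by rewrite !tmapE.
rewrite -comulA /convol /m3 /=; move: (comul x) => X.
elim/tens_ind: X => [|d s t IHs IHt|u v]; first by rewrite !linear0.
  by rewrite !linearP /= IHs IHt.
rewrite !tmapE /= tmultE /convol /=; move: (comul u) => X.
elim/tens_ind: X => [|d s t IHs IHt|u1 u2].
- by rewrite !(pure0l, linear0) amul0l.
- by rewrite !(pureDl, pureZl, linearP) /= amulPl IHs IHt.
by rewrite tassocE !tmapE /= tmapE !tmultE amulA.
Qed.

(* Both sides are convolution inverses of F. *)
Lemma bialg_antipode x : F (antipode x) = antipode (F x).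
Proof.
pose e (y : H) : K := counit y *: aone.
pose FS : {linear H -> K} := F \o antipode.
pose SF : {linear H -> K} := antipode \o F.
have FSl : convol FS F =1 e.
  move=> y; rewrite /convol /e -F1 -linearZ -antipodel; move: (comul y) => X.
  elim/tens_ind: X => [|d s t IHs IHt|u v]; first by rewrite !linear0.
    by rewrite !linearP /= IHs IHt.
  by rewrite !tmapE /= !tmultE FM.
have SFr : convol F SF =1 e.
  move=> y; rewrite /convol /e -F_counit -antipoder F_comul; move: (comul y) => X.
  elim/tens_ind: X => [|d s t IHs IHt|u v]; first by rewrite !linear0.
    by rewrite !linearP /= IHs IHt.
  by rewrite !tmapE /= !tmultE.
have El (a : {linear H -> K}) X :
    tmult K (tmap (convol FS F) a X) = a (tscalel H counit X).
  elim/tens_ind: X => [|d s t IHs IHt|u v]; first by rewrite !linear0.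
    by rewrite !linearP /= IHs IHt.
  by rewrite tmapE /= tmultE FSl tscalelE linearZ amulZl amul1l.
have Er (a : {linear H -> K}) X :
    tmult K (tmap a (convol F SF) X) = a (tscaler H counit X).
  elim/tens_ind: X => [|d s t IHs IHt|u v]; first by rewrite !linear0.
    by rewrite !linearP /= IHs IHt.
  by rewrite tmapE /= tmultE SFr tscalerE linearZ amulZr amul1r.
(* The threefold convolution of [FS], [F], [SF] collapses to [FS] in one bracketing and to [SF] in
   the other. *)
have := convolA FS F SF x.
by rewrite {1}/convol Er {1}/convol El counitl counitr.
Qed.
End BialgebraMaps.

(** * The map φ attached to an algebra map *)

Section AugmentationPart.
Variables (k : fieldType) (H : bialgType k) (A : uAlgType k) (f : algHom H A).

Definition augpart (h : H) : A := f h - counit h *: aone.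
Fact augpart_is_linear : linear augpart.
Proof.
move=> a x y; rewrite /augpart !linearP /= scalerBr scalerDl scalerA opprD.
by rewrite addrACA.
Qed.
HB.instance Definition _ :=
  GRing.isLinear.Build k H A *:%R augpart augpart_is_linear.

Lemma augpart1 : augpart aone = 0.
Proof. by rewrite /augpart (alg_fun_monoid f).1 counit1 scale1r subrr. Qed.
End AugmentationPart.

(** * The evaluation π and the recursion satisfied by words *)

Section QShCofree.
Variables (k : fieldType) (A : uAlgType k).
Local Notation word := (@word k A).

Lemma counit_wcons (a : A) (x : QSh A) : counit (wcons a x) = 0.
Proof. exact: qsh_counit_cons. Qed.

Lemma comul_wcons (a : A) (x : QSh A) :
  comul (wcons a x) = aone ⊗ wcons a x + tmap (wcons a) idfun (comul x).
Proof. exact: qsh_comul_cons. Qed.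

Definition letter_eval (s : seq A) : A :=
  match s with [::] => aone | [:: a] => a | _ => 0 end.

Fact letter_eval_multilin : multilin letter_eval.
Proof.
move=> [|d [|e s]] [|d' t] c a b //=; rewrite ?scaler0 ?addr0 //.
Qed.

Definition qsh_eval : QSh A -> A := wlift letter_eval_multilin.
HB.instance Definition _ := GRing.isLinear.Build k (QSh A) A *:%R
  qsh_eval (wlift_is_linear letter_eval_multilin).

Lemma qsh_evalE s : qsh_eval (word s) = letter_eval s.
Proof. exact: (wliftE letter_eval_multilin). Qed.

(** Only an empty tail leaves a one-letter word, and the counit detects it. *)
Lemma qsh_eval_wcons a x : qsh_eval (wcons a x) = counit x *: a.
Proof.
elim/word_ind: x => [|c x y IHx IHy|s]; first by rewrite !linear0 scale0r.
  by rewrite !linearP /= IHx IHy scalerDl scalerA.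
rewrite wconsE qsh_evalE [counit _]qsh_counitE.
by case: s => [|b s]; rewrite ?scale1r ?scale0r.
Qed.

Fact qsh_eval_monoid : monoid_map qsh_eval.
Proof.
split=> [|x y]; first by rewrite qsh1E qsh_evalE.
elim/word_ind: x => [|c x x' IHx IHx'|v].
- by rewrite amul0l !linear0 amul0l.
- by rewrite amulPl !linearP /= amulPl IHx IHx'.
elim/word_ind: y => [|c x x' IHx IHx'|w].
- by rewrite amul0r !linear0 amul0r.
- by rewrite amulPr !linearP /= amulPr IHx IHx'.
have E1 : qsh_eval (word [::]) = aone by rewrite qsh_evalE.
case: v => [|a v]; first by rewrite E1 !amul1l.
case: w => [|b w]; first by rewrite E1 !amul1r.
(* Two of the three quasi-shuffle terms have a tail with a nonempty factor, hence counit zero; only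
   the contracted term, starting with [a ⋅ b], survives. *)
rewrite -!wconsE qshM_cons !linearD /= !qsh_eval_wcons !counitM.
by rewrite !counit_wcons mulr0 mul0r !scale0r !add0r amulZl amulZr scalerA.
Qed.

Definition qsh_eval_alg : algHom (QSh A) A :=
  AlgHom (wlift_is_linear letter_eval_multilin : linear qsh_eval) qsh_eval_monoid.

Fact wcons_bilin : bilin (fun (a : A) (x : QSh A) => wcons a x).
Proof. by split=> [x c a b|a c x y]; [exact: wconsPl | exact: linearP]. Qed.

(** Prepending as a linear map on tensors turns the sum Σ φ(h') · F(h'') into a composite of linear
    maps. *)
Definition tcons : tens A (QSh A) -> QSh A := tlift wcons_bilin.
HB.instance Definition _ := GRing.isLinear.Build k (tens A (QSh A)) (QSh A) *:%R
  tcons (tlift_is_linear wcons_bilin).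
Lemma tconsE a x : tcons (a ⊗ x) = wcons a x.
Proof. exact: (tliftE wcons_bilin). Qed.

Lemma counit_tcons X : counit (tcons X) = 0.
Proof.
elim/tens_ind: X => [|c s t IHs IHt|u v]; first by rewrite !linear0.
  by rewrite !linearP /= IHs IHt mulr0 addr0.
by rewrite tconsE counit_wcons.
Qed.

Local Notation letter := (augpart qsh_eval_alg).

Lemma letter_wcons a x : letter (wcons a x) = counit x *: a.
Proof. by rewrite /augpart /= qsh_eval_wcons counit_wcons scale0r subr0. Qed.

(** Among the deconcatenations of a nonempty word, [letter] keeps only the one whose left part is a
    single letter. This is the recursion for the identity map. *)
Lemma qsh_unfold (x : QSh A) :
  x = counit x *: aone + tcons (tmap letter idfun (comul x)).
Proof.
elim/word_ind: x => [|c x y IHx IHy|s]; first by rewrite !linear0 scale0r addr0.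
  by rewrite !linearP /= scalerDl -scalerA addrACA -scalerDr -IHx -IHy.
case: s => [|a s].
  by rewrite -qsh1E counit1 scale1r comul_monoid.1 tens1E tmapE /= augpart1 pure0l linear0 addr0.
rewrite -wconsE counit_wcons scale0r add0r comul_wcons linearD /= tmapE /=.
rewrite augpart1 pure0l add0r.
have -> X : tmap letter idfun (tmap (wcons a) idfun X) = a ⊗ tscalel (QSh A) counit X.
  elim/tens_ind: X => [|d s' t IHs IHt|u v]; first by rewrite !linear0 pure0r.
    by rewrite !linearP /= IHs IHt !pureE.
  by rewrite !tmapE /= letter_wcons tscalelE !pureE.
by rewrite counitl tconsE.
Qed.

(** * Truncation by word length *)

Fact trunc_multilin n : multilin (fun s => if (size s < n)%N then word s else 0).
Proof.
move=> s t c a b; rewrite !size_cat /=; case: ifP => _; first exact: word_multilin.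
by rewrite scaler0 addr0.
Qed.

(** The bound on the length is strict, so that level 0 vanishes and starts the inductions. *)
Definition trunc n : QSh A -> QSh A := wlift (trunc_multilin n).
HB.instance Definition _ n := GRing.isLinear.Build k (QSh A) (QSh A) *:%R
  (trunc n) (wlift_is_linear (trunc_multilin n)).

Lemma truncE n s : trunc n (word s) = if (size s < n)%N then word s else 0.
Proof. exact: (wliftE (trunc_multilin n)). Qed.

Lemma trunc0 x : trunc 0 x = 0.
Proof.
elim/word_ind: x => [|c x y IHx IHy|s]; first by rewrite !linear0.
  by rewrite linearP /= IHx IHy scaler0 addr0.
by rewrite truncE.
Qed.

(** Through this shift by one, a recursion that prepends a letter determines level [n.+1] from level
    [n]. *)
Lemma trunc_wcons n a x : trunc n.+1 (wcons a x) = wcons a (trunc n x).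
Proof.
elim/word_ind: x => [|c x y IHx IHy|s]; first by rewrite !linear0.
  by rewrite !linearP /= IHx IHy.
by rewrite wconsE !truncE ltnS; case: ifP => _; rewrite ?wconsE ?linear0.
Qed.

Lemma trunc_id x : exists N, forall n, (N <= n)%N -> trunc n x = x.
Proof.
elim/word_ind: x => [|c x y [N IHx] [M IHy]|s].
- by exists 0 => n _; rewrite linear0.
- by exists (maxn N M) => n; rewrite geq_max => /andP[/IHx Ex /IHy Ey]; rewrite linearP /= Ex Ey.
by exists (size s).+1 => n sn; rewrite truncE sn.
Qed.

Lemma trunc_inj x y : (forall n, trunc n x = trunc n y) -> x = y.
Proof.
move=> E; have [N Ex] := trunc_id x; have [M Ey] := trunc_id y.
by rewrite -(Ex _ (leq_maxl N M)) E Ey // leq_maxr.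
Qed.

(** Truncating the left leg is enough for the coproduct equation, which adds its letters there. *)
Lemma trunc_tens_id (X : tens (QSh A) (QSh A)) :
  exists N, forall n, (N <= n)%N -> tmap (trunc n) idfun X = X.
Proof.
elim/tens_ind: X => [|c x y [N IHx] [M IHy]|u v].
- by exists 0 => n _; rewrite linear0.
- by exists (maxn N M) => n; rewrite geq_max => /andP[/IHx Ex /IHy Ey]; rewrite linearP /= Ex Ey.
by have [N E] := trunc_id u; exists N => n /E {}E; rewrite tmapE /= E.
Qed.

Lemma trunc_tens_inj (X Y : tens (QSh A) (QSh A)) :
  (forall n, tmap (trunc n) idfun X = tmap (trunc n) idfun Y) -> X = Y.
Proof.
move=> E; have [N EX] := trunc_tens_id X; have [M EY] := trunc_tens_id Y.
by rewrite -(EX _ (leq_maxl N M)) E EY // leq_maxr.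
Qed.

Lemma trunc_tens0 (X : tens (QSh A) (QSh A)) : tmap (trunc 0) idfun X = 0.
Proof.
elim/tens_ind: X => [|c x y IHx IHy|u v]; first by rewrite linear0.
  by rewrite linearP /= IHx IHy scaler0 addr0.
by rewrite tmapE /= trunc0 pure0l.
Qed.
End QShCofree.
Arguments tcons {k A}.

(** * Iterated reduced coproducts *)

Lemma tmap_idr (k : fieldType) (U V W Z : lmodType k) (h : {linear V -> Z}) (g : {linear V -> W})
    (E : {linear W -> Z}) :
    (forall v, h v = E (g v)) ->
  forall X : tens U V, tmap idfun h X = tmap idfun E (tmap idfun g X).
Proof.
move=> hE X; elim/tens_ind: X => [|c s t IHs IHt|u v]; first by rewrite !linear0.
  by rewrite !linearP /= IHs IHt.
by rewrite !tmapE /= hE.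
Qed.

Section ReducedCoproduct.
Variables (k : fieldType) (H : bialgType k).

(** Unrolling the recursion, the additional reduced coproduct acts on the last tensor factor; [E] is
    that map. Hence vanishing persists at higher iterates. *)
Lemma redcomul_iterS n : exists E : {linear tpow H n -> tpow H n.+1},
  forall x, redcomul_iter H n.+1 x = E (redcomul_iter H n x).
Proof.
elim: n => [|n [E EE]]; first by exists (redcomul_iter H 1).
exists (tmap idfun E) => x.
exact: (tmap_idr EE (redcomul x)).
Qed.

Lemma redcomul_iter_ge n m x :
  (n <= m)%N -> redcomul_iter H n x = 0 -> redcomul_iter H m x = 0.
Proof.
move=> /subnK <- E0; elim: (m - n)%N => [//|d IHd].
by have [E EE] := redcomul_iterS (d + n); rewrite addSn EE IHd linear0.
Qed.
End ReducedCoproduct.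

(** * Existence of a solution as a pointwise limit *)

Section Approximation.
Variables (k : fieldType) (H : bialgType k) (A : uAlgType k) (f : algHom H A).

Definition counit_unit (x : H) : QSh A := counit x *: aone.
Fact counit_unit_is_linear : linear counit_unit.
Proof. by move=> a x y; rewrite /counit_unit linearP scalerDl scalerA. Qed.
HB.instance Definition _ :=
  GRing.isLinear.Build k H (QSh A) *:%R counit_unit counit_unit_is_linear.

Definition cofree_step (L : {linear H -> QSh A}) (x : H) : QSh A :=
  counit x *: aone + tcons (tmap (augpart f) L (comul x)).
Fact cofree_step_is_linear L : linear (cofree_step L).
Proof.
move=> a x y; rewrite /cofree_step !linearP /= scalerDl !scalerA addrACA.
by rewrite [a * _]mulrC.
Qed.
HB.instance Definition _ (L : {linear H -> QSh A}) :=
  GRing.isLinear.Build k H (QSh A) *:%R (cofree_step L) (cofree_step_is_linear L).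

Fixpoint approx n : {linear H -> QSh A} :=
  if n is m.+1 then cofree_step (approx m) else counit_unit.

Lemma cofree_step1 L : cofree_step L aone = aone.
Proof.
rewrite /cofree_step counit1 scale1r comul_monoid.1 tens1E tmapE /= augpart1.
by rewrite pure0l linear0 addr0.
Qed.

Lemma approx1 n : approx n aone = aone.
Proof.
by case: n => [|n] /=; rewrite ?cofree_step1 // /counit_unit counit1 scale1r.
Qed.

(* Since [augpart f] kills 1 and L, L' agree there, only the reduced coproduct
   contributes. *)
Lemma cofree_step_sub (L L' : {linear H -> QSh A}) (W : lmodType k)
    (V : {linear W -> QSh A}) (g : {linear H -> W}) :
    L aone = L' aone -> (forall x, L x - L' x = V (g x)) ->
  forall x, cofree_step L x - cofree_step L' x =
            tcons (tmap (augpart f) V (tmap idfun g (redcomul x))).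
Proof.
move=> E1 E x; rewrite /cofree_step opprD addrACA subrr add0r.
have S X : tcons (tmap (augpart f) L X) - tcons (tmap (augpart f) L' X) =
           tcons (tmap (augpart f) V (tmap idfun g X)).
  elim/tens_ind: X => [|c s t IHs IHt|u v]; first by rewrite !linear0 addr0.
    by rewrite !linearP /= -IHs -IHt addrACA -scalerDr.
  by rewrite !tmapE /= !tconsE -E linearB.
rewrite S /redcomul !linearB /= !tmapE /= -(E aone) E1 subrr pure0r augpart1 pure0l.
by rewrite linear0 !subr0.
Qed.

Lemma approx_sub n : exists V : {linear tpow H n -> QSh A},
  forall x, approx n.+1 x - approx n x = V (redcomul_iter H n x).
Proof.
elim: n => [|n [V EV]].
  (* [redcomul_iter H 0] is the identity, so [V] is the whole first correction term. *)
  by exists (tcons \o tmap (augpart f) counit_unit \o comul) => x; rewrite addrC addKr.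
exists (tcons \o tmap (augpart f) V) => x.
by rewrite (cofree_step_sub _ EV) // !approx1.
Qed.

Lemma approx_stable (cH : conilpotent H) x :
  exists N, forall n, (N <= n)%N -> approx n x = approx N x.
Proof.
(* Conilpotence concerns the kernel of the counit, so the multiple of 1 is split off; every
   approximation fixes 1. *)
pose y := x - counit x *: aone.
have [|N y0] := cH y; first by rewrite linearB linearZ /= counit1 mulr1 subrr.
have Ey m : approx m x = approx m y + counit x *: aone.
  by rewrite -{1}(subrK (counit x *: aone) x) -/y linearD linearZ /= approx1.
exists N => n /subnK <-; rewrite !Ey; congr (_ + _).
elim: (n - N)%N => [//|d IHd]; rewrite addSn -{}IHd; apply/eqP.
have [V EV] := approx_sub (d + N).
by rewrite -subr_eq0 EV (redcomul_iter_ge _ y0) ?leq_addl // linear0.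
Qed.


Lemma cofree_solution (cH : conilpotent H) : exists F : {linear H -> QSh A},
  forall x, F x = counit x *: aone + tcons (tmap (augpart f) F (comul x)).
Proof.
have lim x : exists y, exists N, forall n, (N <= n)%N -> approx n x = y.
  by have [N E] := approx_stable cH x; exists (approx N x), N.
have [F0 F0E] := choice lim.
have F0_linear : linear F0.
  move=> a x y; have [N1 E1] := F0E (a *: x + y).
  have [N2 E2] := F0E x; have [N3 E3] := F0E y.
  pose n := (N1 + N2 + N3)%N.
  have n1 : (N1 <= n)%N by rewrite /n -addnA leq_addr.
  have n2 : (N2 <= n)%N by rewrite /n addnAC leq_addl.
  by rewrite -(E1 n n1) -(E2 n n2) -(E3 n (leq_addl _ _)) linearP.
pose lF := GRing.isLinear.Build k H (QSh A) *:%R F0 F0_linear.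
pose F : {linear H -> QSh A} := HB.pack F0 lF.
exists F => x.
(* [comul x] is a finite sum of pure tensors, so a single index stabilizes all their right legs. *)
have [N EN] : exists N, forall n, (N <= n)%N ->
    tmap (augpart f) (approx n) (comul x) = tmap (augpart f) F (comul x).
  elim/tens_ind: (comul x) => [|c s t [N1 E1] [N2 E2]|u v].
  - by exists 0 => n _; rewrite !linear0.
  - exists (maxn N1 N2) => n; rewrite geq_max => /andP[/E1 {}E1 /E2 {}E2].
    by rewrite !linearP /= E1 E2.
  by have [N E] := F0E v; exists N => n /E {}E; rewrite !tmapE E.
have [M EM] := F0E x.
(* [M] handles [x] and [N] its coproduct; the successor exposes one [cofree_step]. *)
by rewrite -[LHS]/(F0 x) -(EM (maxn M N).+1) 1?leqW ?leq_maxl //= /cofree_step EN ?leq_maxr.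
Qed.
End Approximation.

(** * Injectivity and surjectivity of composition with π *)

Section Correspondence.
Variables (k : fieldType) (H : hopfAlgType k) (A : uAlgType k).
Local Notation eval := (qsh_eval_alg A).

Lemma augpart_eval (F : hopfHom H (QSh A)) x :
  augpart eval (F x) = augpart (alg_comp eval F) x.
Proof. by rewrite /augpart hopf_counit. Qed.

Lemma qsh_eval_comp_inj (F G : hopfHom H (QSh A)) :
  alg_comp eval F =1 alg_comp eval G -> F = G.
Proof.
move=> FG; apply: hopfHom_eq => x; apply: trunc_inj => n.
elim: n x => [|n IHn] x; first by rewrite !trunc0.
(* Compatibility with counit and coproduct turns [qsh_unfold] at [F x] into the recursion for
   [F]. *)
rewrite (qsh_unfold (F x)) (qsh_unfold (G x)) !hopf_counit !hopf_comul !linearD /=.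
congr (_ + _); move: (comul x) => X.
elim/tens_ind: X => [|c s t IHs IHt|u v]; first by rewrite !linear0.
  by rewrite !linearP /= IHs IHt.
rewrite !tmapE /= !tconsE !trunc_wcons IHn !augpart_eval.
by rewrite /augpart FG.
Qed.

Variable f : algHom H A.

Section Solution.
Variable F : {linear H -> QSh A}.
Hypothesis F_unfold : forall x,
  F x = counit x *: aone + tcons (tmap (augpart f) F (comul x)).

Lemma solution_counit x : counit (F x) = counit x.
Proof.
by rewrite F_unfold linearD linearZ /= counit_tcons counit1 mulr1 addr0.
Qed.

Lemma solution1 : F aone = aone.
Proof.
rewrite F_unfold counit1 scale1r comul_monoid.1 tens1E tmapE /= augpart1.
by rewrite pure0l linear0 addr0.
Qed.

(** Evaluation keeps the first letter and weighs the tail by its counit; the right counit axiom then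
    leaves ε 1 + φ = f. *)
Lemma solution_eval x : qsh_eval (F x) = f x.
Proof.
rewrite F_unfold linearD linearZ /= (qsh_eval_monoid A).1.
have -> X : qsh_eval (tcons (tmap (augpart f) F X)) = augpart f (tscaler H counit X).
  elim/tens_ind: X => [|c s t IHs IHt|u v]; first by rewrite !linear0.
    by rewrite !linearP /= IHs IHt.
  by rewrite tmapE /= tconsE qsh_eval_wcons solution_counit tscalerE linearZ.
by rewrite counitr addrC subrK.
Qed.

Lemma solution_augpart x : augpart eval (F x) = augpart f x.
Proof. by rewrite /augpart /= solution_eval solution_counit. Qed.

(* Both comul \o F and (F ⊗ F) \o comul solve D x = 1 ⊗ F x + Σ (φ x' · _) ⊗ id (D x''),
   whose right-hand side adds a letter on the left. *)
Lemma solution_comul x : comul (F x) = tmap F F (comul x).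
Proof.
pose C a : {linear tens (QSh A) (QSh A) -> tens (QSh A) (QSh A)} := tmap (wcons a) idfun.
have C_bilin : bilin (fun (a : A) X => C a X).
  by split=> [X c a b|a c X Y]; [exact: tmap_wconsPl | exact: linearP].
pose S (D : {linear H -> tens (QSh A) (QSh A)}) X := tlift C_bilin (tmap (augpart f) D X).
pose D1 : {linear H -> tens (QSh A) (QSh A)} := comul \o F.
pose D2 : {linear H -> tens (QSh A) (QSh A)} := tmap F F \o comul.
have E1 y : D1 y = aone ⊗ F y + S D1 (comul y).
  rewrite /D1 /= {1 2}F_unfold linearD linearZ /= comul_monoid.1 tens1E.
  rewrite pureDr pureZr -addrA; congr (_ + _); rewrite /S; move: (comul y) => X.
  elim/tens_ind: X => [|c s t IHs IHt|u v]; first by rewrite !linear0 pure0r addr0.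
    by rewrite !linearP /= IHs IHt !pureE scalerDr addrACA.
  by rewrite !tmapE /= tconsE comul_wcons tliftE.
(* By coassociativity the second coproduct can act on the left leg, where [F_unfold] applies; its
   counit part gives the term [aone ⊗ F y]. *)
have E2 y : D2 y = aone ⊗ F y + S D2 (comul y).
  pose T Z := tlift C_bilin (tmap (augpart f) (tmap F F) Z).
  have -> : S D2 (comul y) = T (tmap idfun comul (comul y)).
    rewrite /S /T; move: (comul y) => X.
    elim/tens_ind: X => [|c s t IHs IHt|u v]; first by rewrite !linear0.
      by rewrite !linearP /= IHs IHt.
    by rewrite !tmapE.
  (* Writing [y] as a contraction of [comul y] makes both sides linear in that tensor. *)
  rewrite -comulA /D2 /= -{2}(counitl y); move: (comul y) => X.
  elim/tens_ind: X => [|c s t IHs IHt|u v].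
  - by rewrite /T !linear0 pure0r addr0.
  - by move: IHs IHt; rewrite /T !linearP /= => -> ->; rewrite !pureE scalerDr addrACA.
  rewrite /T !tmapE /= tscalelE linearZ /= (F_unfold u) pureDl pureZl pureZr; congr (_ + _).
  move: (comul u) => X.
  elim/tens_ind: X => [|c s t IHs IHt|u1 u2].
  - by rewrite !(linear0, pure0l).
  - by rewrite !(linearP, pureDl, pureZl) /= IHs IHt.
  by rewrite tassocE !tmapE /= tmapE tliftE /C tmapE /= tconsE.
rewrite -[LHS]/(D1 x) -[RHS]/(D2 x); apply: trunc_tens_inj => n.
elim: n x => [|n IHn] x; first by rewrite !trunc_tens0.
rewrite E1 E2 !linearD /=; congr (_ + _); rewrite /S; move: (comul x) => X.
elim/tens_ind: X => [|c s t IHs IHt|u v]; first by rewrite !linear0.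
  by rewrite !linearP /= IHs IHt.
rewrite !(tmapE (augpart f)) !tliftE.
have CE a X : tmap (trunc n.+1) idfun (C a X) = C a (tmap (trunc n) idfun X).
  elim/tens_ind: X => [|c s t IHs IHt|v1 v2]; first by rewrite !linear0.
    by rewrite !linearP /= IHs IHt.
  by rewrite /C /= !tmapE /= trunc_wcons.
by rewrite !CE IHn.
Qed.

(** By [solution_comul], both sides unfold over products of the two coproducts. First letters agree
    since π and f are multiplicative and π ∘ F = f; tails are again products, at a lower truncation
    level. *)
Lemma solutionM : {morph F : x y / x ⋅ y}.
Proof.
move=> x y; apply: trunc_inj => n.
elim: n x y => [|n IHn] x y; first by rewrite !trunc0.
rewrite (qsh_unfold (F _)) (qsh_unfold (F x ⋅ F y)).
rewrite solution_counit !counitM !solution_counit comul_monoid.2 !solution_comul.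
rewrite comul_monoid.2 !linearD /=; congr (_ + _).
move: (comul x) (comul y) => X Y.
elim/tens_ind: X => [|c s t IHs IHt|u v]; first by rewrite !(linear0, amul0l).
  by rewrite !(linearP, amulPl) /= IHs IHt.
elim/tens_ind: Y => [|c s t IHs IHt|u' v']; first by rewrite !(linear0, amul0r).
  by rewrite !(linearP, amulPr) /= IHs IHt.
rewrite pureM !tmapE pureM tmapE /= !tconsE !trunc_wcons IHn; congr (wcons _ _).
rewrite solution_augpart /augpart /= (qsh_eval_monoid A).2 !solution_eval.
by rewrite (alg_fun_monoid f).2 !counitM !solution_counit.
Qed.

Definition solution_alg : algHom H (QSh A) :=
  AlgHom (linearP F) (conj solution1 solutionM).

Definition solution_hopf : hopfHom H (QSh A) :=
  @HopfHom _ _ _ solution_alg solution_comul solution_counit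
    (bialg_antipode solution1 solutionM solution_comul solution_counit).
End Solution.

Lemma qsh_eval_comp_surj (cH : conilpotent H) :
  exists F : hopfHom H (QSh A), alg_comp eval F = f.
Proof.
have [F FE] := cofree_solution f cH; exists (solution_hopf FE).
by apply: algHom_eq => x; exact: solution_eval.
Qed.
End Correspondence.

(** * Naturality of π and of the bijection *)

Lemma qsh_eval_map (k : fieldType) (A B : uAlgType k) (l : algHom A B) x :
  qsh_eval (qsh_map l x) = l (qsh_eval x).
Proof.
elim/word_ind: x => [|c x y IHx IHy|s]; first by rewrite !linear0.
  by rewrite !linearP /= IHx IHy.
rewrite /= qsh_map_word !qsh_evalE; case: s => [|a [|b s]] //=.
  by rewrite (alg_fun_monoid l).1.
by rewrite linear0.
Qed.

Theorem theorem1 (k : fieldType) (char0 : [pchar k] =i pred0) :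
  exists Phi : forall (H : hopfAlgType k) (A : uAlgType k),
      conilpotent H -> algHom H A -> hopfHom H (QSh A),
    (forall (H : hopfAlgType k) (A : uAlgType k) (cH : conilpotent H),
       bijective (Phi H A cH)) /\
    (forall (H H' : hopfAlgType k) (A B : uAlgType k)
       (cH : conilpotent H) (cH' : conilpotent H')
       (g : hopfHom H' H) (l : algHom A B) (f : algHom H A),
       Phi H' B cH' (alg_comp l (alg_comp f g)) =
       hopf_comp (qsh_map l) (hopf_comp (Phi H A cH f) g)).
Proof.
(* The preimage picked by [cid] is unique by [qsh_eval_comp_inj], so independent choices are still
   natural. *)
pose Phi (H : hopfAlgType k) (A : uAlgType k) (cH : conilpotent H) (f : algHom H A) :=
  sval (cid (qsh_eval_comp_surj f cH)).
have PhiK H A cH f : alg_comp (qsh_eval_alg A) (Phi H A cH f) = f.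
  exact: (svalP (cid (qsh_eval_comp_surj f cH))).
exists Phi; split=> [H A cH|H H' A B cH cH' g l f].
  exists (fun F : hopfHom H (QSh A) => alg_comp (qsh_eval_alg A) F) => [f|F].
    exact: PhiK.
  by apply: qsh_eval_comp_inj => x; rewrite PhiK.
(* It suffices to compare composites with π; [qsh_eval_map] carries π past [qsh_map l], and both
   become l ∘ f ∘ g. *)
apply: qsh_eval_comp_inj => x; rewrite PhiK /=.
rewrite -[qsh_map_fun l _]/(qsh_map l _) qsh_eval_map; congr (l _).
by rewrite -[in LHS](PhiK H A cH f).
Qed.
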